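(* Let $1\leqslant p<2$ and let $\gamma,\tilde{\gamma}:[0,1]\rightarrow\mathbb{R}^{2}$ be Jordan curves with finite $p$-variation. Then $S(\gamma)_{0,1}=S(\tilde{\gamma})_{0,1}$ if and only if $\gamma$ and $\tilde{\gamma}$ are a translation and a reparametrization of each other, i.e. if and only if there exist $a\in\mathbb{R}^2$ and a continuous increasing function $r:[0,1]\to[0,1]$ such that $\tilde{\gamma}_t=a+\gamma_{r(t)}$ for all $t\in[0,1]$.
   Context: A Jordan curve is a continuous map $\gamma:[0,1]\to\mathbb{R}^2$ with $\gamma_0=\gamma_1$ that is injective on $[0,1)$. A function $\gamma:[0,1]\to\mathbb{R}^d$ has finite $p$-variation if $\sup_{\mathcal{P}}\sum_{i}|\gamma_{t_{i+1}}-\gamma_{t_i}|^p<\infty$, the supremum being over all finite partitions $\mathcal{P}:t_0<t_1<\cdots<t_n$ of $[0,1]$. Young integral: if $\phi,\psi$ are continuous paths with finite $p$-variation, $1\leqslant p<2$, then $\int_0^t\phi_s\otimes\mathrm{d}\psi_s:=\lim_{\|\mathcal{P}\|\to0}\sum_i\phi_{t_i}\otimes(\psi_{t_{i+1}}-\psi_{t_i})$ over finite partitions $\mathcal{P}$ of $[0,t]$ with mesh tending to $0$; the limit exists and, as a function of $t$, is continuous with finite $p$-variation. Signature: for a continuous path $\gamma:[0,1]\to\mathbb{R}^d$ with finite $p$-variation, $1\leqslant p<2$, its signature over $[0,1]$ is the formal series of tensors $$S(\gamma)_{0,1}:=1+\sum_{i=1}^{\infty}\int_{0<s_1<\cdots<s_i<1}\mathrm{d}\gamma_{s_1}\otimes\cdots\otimes\mathrm{d}\gamma_{s_i},$$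 whose $i$-th term lies in $(\mathbb{R}^d)^{\otimes i}$ and is an iterated Young integral, i.e. it is the value at $t=1$ of $X^{i}_t$, where $X^1_t=\gamma_t-\gamma_0$ and $X^{i+1}_t=\int_0^t X^i_s\otimes\mathrm{d}\gamma_s$. Equality of signatures means equality of the terms in every $(\mathbb{R}^d)^{\otimes i}$, $i\geqslant 1$. *)

(* Defs.v *)
From HB Require Import structures.
From mathcomp Require Import all_boot all_order all_algebra.
From mathcomp Require Import all_classical all_reals all_analysis.

Set Implicit Arguments.
Unset Strict Implicit.
Unset Printing Implicit Defensive.

Import Order.TTheory GRing.Theory Num.Theory.
Import numFieldNormedType.Exports.

Local Open Scope classical_set_scope.
Local Open Scope ring_scope.

(* Paths [0, 1] -> R^d are functions R -> 'rV[R]_d; only their restriction to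
   `[0, 1] is ever used. *)

(* The library norm on 'rV[R]_d is the sup norm. *)
Definition enorm (R : realType) (d : nat) (x : 'rV[R]_d) : R :=
  Num.sqrt (\sum_(i < d) x 0 i ^+ 2).

(* With itv_partition a b s, the points of the partition are those of a :: s,
   and those of s are the right endpoints of its intervals. *)
Definition pvariation (R : realType) (d : nat) (p a b : R)
    (gamma : R -> 'rV[R]_d) (s : seq R) : R :=
  \sum_(0 <= i < size s)
    enorm (gamma (nth b (a :: s) i.+1) - gamma (nth b (a :: s) i)) `^ p.

Definition finite_pvariation (R : realType) (d : nat) (p a b : R)
    (gamma : R -> 'rV[R]_d) : Prop :=
  has_ubound (pvariation p a b gamma @` [set s | itv_partition a b s]).

Definition jordan_curve (R : realType) (gamma : R -> 'rV[R]_2) : Prop :=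
  [/\ {within `[0, 1], continuous gamma},
      gamma 0 = gamma 1 &
      {in `[0, 1[ &, injective gamma}].

Definition mesh (R : realType) (a b : R) (s : seq R) : R :=
  \big[Num.max/0]_(0 <= i < size s)
    (nth b (a :: s) i.+1 - nth b (a :: s) i).

(* The filter "partitions of [a, b] with mesh tending to 0"; it is proper when
   a <= b. *)
Definition mesh_to0 (R : realType) (a b : R) : set_system (seq R) :=
  within [set s | itv_partition a b s]
    (filter_from [set e : R | 0 < e] (fun e => [set s | mesh a b s < e])).

(* R^m (x) R^n is represented by 'rV[R]_(m * n): the entry of u (x) v at
   mxvec_index i j is u_i v_j. *)
Definition tensor (R : realType) (m n : nat) (u : 'rV[R]_m) (v : 'rV[R]_n) :
    'rV[R]_(m * n) :=
  mxvec (u^T *m v).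

Definition young_sum (R : realType) (m n : nat) (a b : R)
    (phi : R -> 'rV[R]_m) (psi : R -> 'rV[R]_n) (s : seq R) : 'rV[R]_(m * n) :=
  \sum_(0 <= i < size s)
    tensor (phi (nth b (a :: s) i))
           (psi (nth b (a :: s) i.+1) - psi (nth b (a :: s) i)).

Definition young_integral (R : realType) (m n : nat) (a b : R)
    (phi : R -> 'rV[R]_m) (psi : R -> 'rV[R]_n) : 'rV[R]_(m * n) :=
  lim (young_sum a b phi psi s @[s --> mesh_to0 a b]).

(* Index shift: tensor_dim d k is the dimension of the (k+1)-st tensor power of
   R^d. *)
Fixpoint tensor_dim (d k : nat) : nat :=
  if k is k'.+1 then (tensor_dim d k' * d)%N else d.

(* iterated_integral gamma k t is X^{k+1}_t. *)
Fixpoint iterated_integral (R : realType) (d : nat) (gamma : R -> 'rV[R]_d)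
    (k : nat) : R -> 'rV[R]_(tensor_dim d k) :=
  match k return R -> 'rV[R]_(tensor_dim d k) with
  | 0%N => fun t => gamma t - gamma 0
  | k'.+1 => fun t => young_integral 0 t (iterated_integral gamma k') gamma
  end.

(* The term in degree k+1; the term in degree 0 is always 1 and is omitted. *)
Definition signature (R : realType) (d : nat) (gamma : R -> 'rV[R]_d)
    (k : nat) : 'rV[R]_(tensor_dim d k) :=
  iterated_integral gamma k 1.

(* Main.v *)
(* The argument uses neither the Jordan curve theorem nor winding numbers.

   Young calculus.  If [|f_v - f_u|] and [|g_v - g_u|] are at most a constant
   times [(W_v - W_u)^a] for an increasing [W] and some [a > 1/2], then
   [Y = int f dg] is characterized up to a constant by
   [Y_v - Y_u = f_u (g_v - g_u) + o(W_v - W_u)], uniformly as [v - u -> 0].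
   Associativity and integration by parts are then immediate, so products of
   coordinates of the signature with [gamma - gamma_0] are again linear
   combinations of coordinates of the signature.  Hence the signature determines
   [int P(gamma - gamma_0) dQ(gamma - gamma_0)] for polynomials [P], [Q], and, by
   density in the Lipschitz norm, [int chi dtheta] along [gamma - gamma_0] for the
   functions [chi], [theta] that are C^1-limits of polynomials; these separate
   disjoint compact sets.

   Local nonvanishing.  Let [s < s1 < t1 < t], let [chi = 1] on the arc [[s1, t1]]
   and [chi = 0] off the arc [[s, t]], let [theta = 0] on [[s, s1]] and [theta = 1]
   on [[t1, t]].  For an injective curve such functions exist, and
   [int chi dtheta = 1]: only the arc [[s1, t1]] contributes, and there the integral
   telescopes.  If [gamma'] left the image of [gamma] (both starting at [0]), one
   could take [chi = 0] on [gamma], a contradiction.  So [gamma' = gamma o r] with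
   [r] continuous and injective on [(0, 1)]; if [r] were decreasing, the same
   integral would be [-1] along [gamma]. *)
Require Import Defs.
From HB Require Import structures.
From mathcomp Require Import all_boot all_order all_algebra.
From mathcomp Require Import all_classical all_reals all_analysis.
From mathcomp Require Import polyrcf ring lra.
Import Order.TTheory GRing.Theory Num.Theory.
Import numFieldNormedType.Exports.
Local Open Scope classical_set_scope.
Local Open Scope ring_scope.

Set Implicit Arguments.
Unset Strict Implicit.

(** * Riemann-Stieltjes differentials *)

Section Differentials.
Variable R : realType.
Implicit Types (W f g h X Y Z : R -> R) (a b c e t u v : R).

Definition unif_cont01 f := forall e, 0 < e -> exists2 d, 0 < d &
  forall u v, 0 <= u -> u <= v -> v <= 1 -> v - u < d -> `|f v - f u| <= e.

(** The total mass is normalized to at most 1 so that [(W_v - W_u)^b] decreases in the exponent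
    [b]. *)
Definition control W :=
  (forall u v, 0 <= u -> u <= v -> v <= 1 -> W u <= W v) /\ W 1 - W 0 <= 1.

Definition holder W a c f := forall u v, 0 <= u -> u <= v -> v <= 1 ->
  `|f v - f u| <= c * (W v - W u) `^ a.

(** A control may jump, so a bound by a power of its increments does not give continuity, which is
    therefore recorded separately. *)
Definition young_path W a f :=
  unif_cont01 f /\ exists2 c, 0 <= c & holder W a c f.

(* Such a local error is killed by summation over a fine partition. *)
Definition small_defect W (E : R -> R -> R) := forall e, 0 < e ->
  exists2 d, 0 < d & forall u v, 0 <= u -> u <= v -> v <= 1 -> v - u < d ->
  `|E u v| <= e * (W v - W u).

(* [dint W f g Y] expresses [dY = f dg]. *)
Definition dint W f g Y :=
  small_defect W (fun u v => Y v - Y u - f u * (g v - g u)).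

Definition subdiv a b (n k : nat) : R := a + (b - a) * (k%:R / n.+1%:R).

Lemma subdiv0 a b n : subdiv a b n 0 = a.
Proof. by rewrite /subdiv mul0r mulr0 addr0. Qed.

Lemma subdiv_end a b n : subdiv a b n n.+1 = b.
Proof. by rewrite /subdiv divff ?mulr1 ?subrKC// pnatr_eq0. Qed.

Lemma subdiv_incr a b n k : subdiv a b n k.+1 - subdiv a b n k = (b - a) / n.+1%:R.
Proof. by rewrite /subdiv -addn1 natrD; field; rewrite lt0r_neq0//; lra. Qed.

Lemma subdiv_homo a b n : a <= b ->
  {homo subdiv a b n : k l / (k <= l)%N >-> k <= l}.
Proof.
move=> ab k l kl; rewrite /subdiv lerD2l ler_wpM2l ?subr_ge0//.
by rewrite ler_pM2r ?invr_gt0 ?ltr0n// ler_nat.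
Qed.

Lemma subdiv_mesh a b d : a <= b -> 0 < d ->
  exists N : nat, forall n, (N <= n)%N -> (b - a) / n.+1%:R < d.
Proof.
move=> ab d0; exists (Num.truncn ((b - a) / d)) => n Nn.
have h : (b - a) / d < n.+1%:R.
  by rewrite (lt_le_trans (truncnS_gt _))// ler_nat.
by rewrite ltr_pdivrMr ?ltr0n// mulrC -ltr_pdivrMr.
Qed.

Lemma control_sub W u v : control W -> 0 <= u -> u <= v -> v <= 1 ->
  0 <= W v - W u <= 1.
Proof.
move=> [nd W1] u0 uv v1.
have := nd 0 u (lexx _) u0 (le_trans uv v1).
have := nd v 1 (le_trans u0 uv) v1 (lexx _).
have := nd u v u0 uv v1; lra.
Qed.

Lemma sum_control W Y e (x : nat -> R) n :
  (forall k, (k < n)%N -> `|Y (x k.+1) - Y (x k)| <= e * (W (x k.+1) - W (x k))) ->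
  `|Y (x n) - Y (x 0%N)| <= e * (W (x n) - W (x 0%N)).
Proof.
elim: n => [|n IH] h; first by rewrite !subrr normr0 mulr0.
have h1 := IH (fun k kn => h k (ltnW kn)); have h2 := h n (ltnSn n).
have -> : Y (x n.+1) - Y (x 0) = (Y (x n.+1) - Y (x n)) + (Y (x n) - Y (x 0)) by ring.
rewrite (le_trans (ler_normD _ _))// (le_trans (lerD h2 h1))// -mulrDr.
by rewrite subrKA.
Qed.

(** Over a uniform partition of [[a, b]] finer than [d], the increments of [Y] telescope and their
    bounds add up to [e (W b - W a) <= e]; then [e] tends to 0. *)
Lemma small_increments W Y a b : control W -> 0 <= a -> a <= b -> b <= 1 ->
  (forall e, 0 < e -> exists2 d, 0 < d &
    forall u v, a <= u -> u <= v -> v <= b -> v - u < d ->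
    `|Y v - Y u| <= e * (W v - W u)) ->
  Y b = Y a.
Proof.
move=> cW a0 ab b1 H; apply/eqP; rewrite -subr_eq0 -normr_eq0; apply/eqP.
apply/le_anti/andP; split => //.
apply/ler_addgt0Pr => e e0; rewrite add0r.
have [d d0 Hd] := H e e0.
have [N HN] := subdiv_mesh ab d0.
have hs k : (k <= N.+1)%N -> a <= subdiv a b N k <= b.
  move=> kN; rewrite -{1}(subdiv0 a b N) -{4}(subdiv_end a b N).
  by rewrite !subdiv_homo.
have := @sum_control W Y e (subdiv a b N) N.+1.
rewrite subdiv0 subdiv_end => /(_ _)/le_trans; apply.
  move=> k kN; apply: Hd; last by rewrite subdiv_incr HN.
  - by have /andP[] := hs k (ltnW kN).
  - exact: subdiv_homo.
  - by have /andP[] := hs k.+1 kN.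
by have /andP[w0 w1] := control_sub cW a0 ab b1; rewrite ler_piMr// ltW.
Qed.

Lemma ler_norm_eqD (x y z : R) : z = x + y -> `|z| <= `|x| + `|y|.
Proof. by move=> ->; exact: ler_normD. Qed.

Lemma ler_norm_eqB (x y z : R) : z = x - y -> `|z| <= `|x| + `|y|.
Proof. by move=> ->; exact: ler_normB. Qed.

(** The common step of the rules for differentials: sums, scalar multiples and products with a
    bounded function change a defect by such a combination. *)
Lemma small_defect_comb W (E E1 E2 : R -> R -> R) c : control W -> 0 <= c ->
  small_defect W E1 -> small_defect W E2 ->
  (forall u v, 0 <= u -> u <= v -> v <= 1 -> `|E u v| <= c * `|E1 u v| + `|E2 u v|) ->
  small_defect W E.
Proof.
move=> cW c0 H1 H2 H e e0.
have c1 : 0 < c + 1 by lra.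
(* Dividing by [c + 1] instead of [c] covers [c = 0], here and in later estimates. *)
have e1 : 0 < e / (2 * (c + 1)) by rewrite divr_gt0// mulr_gt0.
have e2 : 0 < e / 2 by rewrite divr_gt0.
have [d1 d10 h1] := H1 _ e1; have [d2 d20 h2] := H2 _ e2.
exists (Num.min d1 d2) => [|u v u0 uv v1]; first by rewrite lt_min d10.
rewrite lt_min => /andP[uv1 uv2].
have {}h1 := h1 _ _ u0 uv v1 uv1; have {}h2 := h2 _ _ u0 uv v1 uv2.
have /andP[w0 _] := control_sub cW u0 uv v1.
apply: le_trans (H u v u0 uv v1) _; apply: le_trans (lerD (ler_wpM2l c0 h1) h2) _.
set w := W v - W u in w0 *.
have -> : c * (e / (2 * (c + 1)) * w) + e / 2 * w = (c / (c + 1) + 1) * (e / 2 * w).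
  by field; rewrite gt_eqF.
have : c / (c + 1) <= 1 by rewrite ler_pdivrMr// mul1r; lra.
have : 0 <= e / 2 * w by rewrite mulr_ge0// ltW.
nra.
Qed.

(** Uniqueness of the integral: the terms [f_u (g_v - g_u)] cancel in the difference of the two
    defects, so [Y - Z] has negligible increments. *)
Lemma dint_sub W f g Y Z a b : control W -> 0 <= a -> a <= b -> b <= 1 ->
  dint W f g Y -> dint W f g Z -> Y b - Y a = Z b - Z a.
Proof.
move=> cW a0 ab b1 HY HZ.
suff : Y b - Z b = Y a - Z a by lra.
apply: (@small_increments W (fun t => Y t - Z t) a b cW a0 ab b1) => e e0.
have : small_defect W (fun u v => Y v - Z v - (Y u - Z u)).
  apply: (small_defect_comb cW ler01 HY HZ) => u v _ _ _; rewrite mul1r.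
  by apply: ler_norm_eqB; ring.
move=> /(_ e e0)[d d0 hd]; exists d => // u v au uv vb.
by apply: hd => //; [exact: le_trans au|exact: le_trans b1].
Qed.

(** On [[a, b]] the defect of [Y] is the increment of [Y - c g]. Together with the next lemma this
    evaluates integrals of cut-off functions over the arcs where they are constant. *)
Lemma dint_cst_weight W f g Y a b c : control W -> 0 <= a -> a <= b -> b <= 1 ->
  dint W f g Y -> (forall u, a <= u <= b -> f u = c) ->
  Y b - Y a = c * (g b - g a).
Proof.
move=> cW a0 ab b1 HY fc.
suff : Y b - c * g b = Y a - c * g a by lra.
apply: (@small_increments W (fun t => Y t - c * g t) a b cW a0 ab b1) => e e0.
have [d d0 H] := HY _ e0; exists d => // u v au uv vb uvd.
have := H _ _ (le_trans a0 au) uv (le_trans vb b1) uvd.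
rewrite fc ?au ?(le_trans uv)//.
by congr (`|_| <= _); ring.
Qed.

Lemma dint_cst_integrator W f g Y a b c : control W -> 0 <= a -> a <= b -> b <= 1 ->
  dint W f g Y -> (forall u, a <= u <= b -> g u = c) -> Y b = Y a.
Proof.
move=> cW a0 ab b1 HY gc.
apply: (small_increments cW a0 ab b1) => e e0.
have [d d0 H] := HY _ e0; exists d => // u v au uv vb uvd.
have := H _ _ (le_trans a0 au) uv (le_trans vb b1) uvd.
by rewrite !gc ?subrr ?mulr0 ?subr0 ?au ?vb ?(le_trans uv)// (le_trans au).
Qed.

Lemma dint_ext W f g Y f' g' Y' :
  (forall t, 0 <= t <= 1 -> f t = f' t) -> (forall t, 0 <= t <= 1 -> g t = g' t) ->
  (forall t, 0 <= t <= 1 -> Y t = Y' t) -> dint W f g Y -> dint W f' g' Y'.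
Proof.
move=> ff gg YY H e e0; have [d d0 Hd] := H e e0; exists d => // u v u0 uv v1 uvd.
have hu : 0 <= u <= 1 by rewrite u0 (le_trans uv).
have hv : 0 <= v <= 1 by rewrite v1 (le_trans u0).
by rewrite -!YY// -ff// -!gg//; exact: Hd.
Qed.

Lemma dint_cst W g c : control W -> dint W (cst c) g (fun t => c * g t).
Proof.
move=> cW e e0; exists 1 => // u v u0 uv v1 _.
rewrite /= -mulrBr subrr normr0 mulr_ge0 ?(ltW e0)//.
by have /andP[] := control_sub cW u0 uv v1.
Qed.

Lemma dint_null W f c : control W -> dint W f (cst c) (cst 0).
Proof.
move=> cW e e0; exists 1 => // u v u0 uv v1 _.
rewrite /= !subrr mulr0 subrr normr0 mulr_ge0 ?(ltW e0)//.
by have /andP[] := control_sub cW u0 uv v1.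
Qed.

Lemma dint_linl W f g h Y Z c : control W -> dint W f g Y -> dint W h g Z ->
  dint W (fun t => c * f t + h t) g (fun t => c * Y t + Z t).
Proof.
move=> cW HY HZ; apply: (small_defect_comb cW (normr_ge0 c) HY HZ) => u v _ _ _.
by rewrite -normrM; apply: ler_norm_eqD; ring.
Qed.

Lemma dint_linr W f g h Y Z c : control W -> dint W f g Y -> dint W f h Z ->
  dint W f (fun t => c * g t + h t) (fun t => c * Y t + Z t).
Proof.
move=> cW HY HZ; apply: (small_defect_comb cW (normr_ge0 c) HY HZ) => u v _ _ _.
by rewrite -normrM; apply: ler_norm_eqD; ring.
Qed.

(** The defects of [Z] for [h dX] and for [h f dg] differ by [h_u] times the defect of [X], which
    stays negligible because [h] is bounded. *)
Lemma dint_assoc W f g h X Z c : control W -> 0 <= c ->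
  (forall t, 0 <= t <= 1 -> `|h t| <= c) ->
  dint W f g X -> dint W h X Z <-> dint W (fun t => h t * f t) g Z.
Proof.
move=> cW c0 hc HX.
have bd u v : 0 <= u -> u <= v -> v <= 1 ->
    `|h u * (X v - X u - f u * (g v - g u))| <= c * `|X v - X u - f u * (g v - g u)|.
  by move=> u0 uv v1; rewrite normrM ler_wpM2r// hc// u0 (le_trans uv).
split=> HZ; apply: (small_defect_comb cW c0 HX HZ) => u v u0 uv v1;
  rewrite (le_trans _ (lerD (bd _ _ u0 uv v1) (lexx _)))//.
  by apply: ler_norm_eqD; ring.
by rewrite [leRHS]addrC; apply: ler_norm_eqB; ring.
Qed.

End Differentials.

(** * Discrete Young estimate *)

Section YoungSewing.
Variable R : realType.
Implicit Types (W f g Y : R -> R) (a A B e t u v : R).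

Definition rsum f g (x : nat -> R) (i j : nat) : R :=
  \sum_(i <= k < j) f (x k) * (g (x k.+1) - g (x k)).

Definition half_powR a : R := 2^-1 `^ (a + 2^-1).

(** The fixed point of [K = 2 h K + 2] with [h = half_powR a]: each half of a split sum contributes
    [h K], and the two cross terms contribute 2. *)
Definition young_const a : R := 2 / (1 - 2 * half_powR a).

Lemma half_powR_lt a : 2^-1 < a -> 2 * half_powR a < 1.
Proof.
move=> a2; rewrite /half_powR.
have -> : a + 2^-1 = 1 + (a - 2^-1) by lra.
rewrite powRD; last by rewrite invr_eq0 pnatr_eq0 implybT.
rewrite powRr1 ?invr_ge0// mulrA divff ?mul1r ?pnatr_eq0//.
suff : 2^-1 `^ (a - 2^-1) < 1 `^ (a - 2^-1) :> R by rewrite powR1.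
apply: gt0_ltr_powR; rewrite ?subr_gt0 ?nnegrE ?invr_ge0//.
by rewrite invf_lt1// ltr1n.
Qed.

Lemma young_const_gt0 a : 2^-1 < a -> 0 < young_const a.
Proof. by move=> /half_powR_lt h; rewrite divr_gt0// subr_gt0. Qed.

Lemma young_constM_ge0 a A B : 2^-1 < a -> 0 <= A -> 0 <= B ->
  0 <= young_const a * (A * B).
Proof. by move=> /young_const_gt0/ltW K A0 B0; exact: mulr_ge0 K (mulr_ge0 A0 B0). Qed.

Lemma powR_le1 (x a : R) : 0 <= x <= 1 -> 0 <= a -> x `^ a <= 1.
Proof.
move=> /andP[x0 x1] a0; suff : x `^ a <= 1 `^ a by rewrite powR1.
by apply: ge0_ler_powR; rewrite ?nnegrE.
Qed.

Lemma powR_le_exp (x a b : R) : 0 <= x <= 1 -> 0 < b -> b <= a -> x `^ a <= x `^ b.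
Proof.
move=> /andP[x0 x1] b0 ba; move: x0; rewrite le_eqVlt => /predU1P[<-|x0].
  by rewrite !powR0// gt_eqF// (lt_le_trans b0).
by apply: ger_powR; rewrite ?x0.
Qed.

(* Split the sum where the control is halved; the exponent [a + 1/2 > 1] makes
   the two halves contribute a geometrically smaller error. *)
Lemma young_discrete W a A B (f g : R -> R) (l r : R) (x : nat -> R) (i j : nat) :
  control W -> 2^-1 < a -> 0 <= A -> 0 <= B -> 0 <= l -> r <= 1 ->
  (forall u v, l <= u -> u <= v -> v <= r ->
    `|f v - f u| <= A * (W v - W u) `^ a /\
    `|g v - g u| <= B * (W v - W u) `^ 2^-1) ->
  {homo x : m n / (m <= n)%N >-> m <= n} -> (i <= j)%N ->
  l <= x i -> x j <= r ->
  `|rsum f g x i j - f (x i) * (g (x j) - g (x i))| <=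
    young_const a * (A * B) * (W (x j) - W (x i)) `^ (a + 2^-1).
Proof.
move=> cW a2 A0 B0 l0 r1 H hx.
have a0 : 0 < a by lra.
have th0 : 0 < a + 2^-1 by lra.
have K0 := young_const_gt0 a2.
have [n] := ubnP (j - i)%N; elim: n i j => // n IH i j jin ij lxi xjr.
have xr k : (k <= j)%N -> x k <= r by move=> /hx/le_trans; apply.
have lx k : (i <= k)%N -> l <= x k by move=> /hx; exact: le_trans.
have wge0 k m : (i <= k)%N -> (k <= m)%N -> (m <= j)%N -> 0 <= W (x m) - W (x k) <= 1.
  move=> ik km mj; apply: control_sub => //; first exact: le_trans l0 (lx _ ik).
    exact: hx.
  exact: le_trans (xr _ mj) r1.
move: ij; rewrite leq_eqVlt => /predU1P[<-|ij].
  rewrite /rsum big_geq// !subrr mulr0 subr0 normr0 mulr_ge0 ?powR_ge0//.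
  exact: young_constM_ge0.
set w := W (x j) - W (x i).
have /andP[w0 w1] : 0 <= w <= 1 by apply: wge0 => //; exact: ltnW.
(* The maximal such [m] leaves at most half of the control after [m.+1]. The interval from [m] to
   [m.+1] may carry any share of it and is kept apart. *)
pose P m := (i <= m < j)%N && (W (x m) - W (x i) <= w / 2).
have exP : exists m, P m by exists i; rewrite /P leqnn ij/= subrr divr_ge0.
have ubP m : P m -> (m <= j)%N by move=> /andP[/andP[_ /ltnW]].
case: (ex_maxnP exP ubP) => m /andP[/andP[im mj] wm] maxm.
have wm' : W (x j) - W (x m.+1) <= w / 2.
  move: (mj); rewrite leq_eqVlt => /predU1P[->|mj']; first by rewrite subrr divr_ge0.
  have : ~~ P m.+1 by apply/negP => /maxm; rewrite ltnn.
  rewrite /P mj' (leq_trans im)//= -ltNge => h.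
  by move: h; rewrite /w; lra.
have mj1 : (m - i < n)%N.
  by rewrite (leq_trans _ (_ : (j - i <= n)%N)) ?ltn_sub2r// -ltnS.
have mj2 : (j - m.+1 < n)%N.
  by rewrite (leq_trans _ (_ : (j - i <= n)%N)) ?ltn_sub2l// -ltnS.
have IH1 := IH i m mj1 im lxi (xr _ (ltnW mj)).
have IH2 := IH m.+1 j mj2 mj (lx _ (leqW im)) xjr.
have pw v : 0 <= v <= w / 2 -> v `^ (a + 2^-1) <= half_powR a * w `^ (a + 2^-1).
  move=> /andP[v0 vw]; rewrite /half_powR -powRM ?invr_ge0//.
  by apply: ge0_ler_powR; rewrite ?nnegrE ?(ltW th0)//; lra.
have {IH1}IH1 := le_trans IH1 (ler_wpM2l (_ : 0 <= young_const a * (A * B)) (pw _ _)).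
have {IH2}IH2 := le_trans IH2 (ler_wpM2l (_ : 0 <= young_const a * (A * B)) (pw _ _)).
have KAB := young_constM_ge0 a2 A0 B0.
have {}IH1 := IH1 KAB _; have {}IH2 := IH2 KAB _.
have {}IH1 : `|rsum f g x i m - f (x i) * (g (x m) - g (x i))| <=
     young_const a * (A * B) * (half_powR a * w `^ (a + 2^-1)).
  by apply: IH1; rewrite wm andbT; have /andP[] := wge0 i m (leqnn _) im (ltnW mj).
have {}IH2 : `|rsum f g x m.+1 j - f (x m.+1) * (g (x j) - g (x m.+1))| <=
     young_const a * (A * B) * (half_powR a * w `^ (a + 2^-1)).
  by apply: IH2; rewrite wm' andbT; have /andP[] := wge0 m.+1 j (leqW im) mj (leqnn _).
have bd k p q : (i <= k)%N -> (k <= p)%N -> (p <= q)%N -> (q <= j)%N ->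
    `|(f (x p) - f (x k)) * (g (x q) - g (x p))| <= A * B * w `^ (a + 2^-1).
  move=> ik kp pq qj; rewrite normrM.
  have pj := leq_trans pq qj; have kj := leq_trans kp pj; have ip := leq_trans ik kp.
  have [h1 _] := H (x k) (x p) (lx _ ik) (hx _ _ kp) (xr _ pj).
  have [_ h2] := H (x p) (x q) (lx _ ip) (hx _ _ pq) (xr _ qj).
  have wle k' p' : (i <= k')%N -> (k' <= p')%N -> (p' <= j)%N ->
      W (x p') - W (x k') <= w.
    move=> ik' kp' pj'.
    have := wge0 i k' (leqnn _) ik' (leq_trans kp' pj').
    have := wge0 p' j (leq_trans ik' kp') pj' (leqnn _).
    by rewrite /w; lra.
  rewrite powRD; last by rewrite gt_eqF.
  rewrite mulrACA; apply: ler_pM => //.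
  - apply: le_trans h1 _; rewrite ler_wpM2l// ge0_ler_powR ?nnegrE ?(ltW a0)//.
      by have /andP[] := wge0 k p ik kp pj.
    exact: wle.
  - apply: le_trans h2 _; rewrite ler_wpM2l// ge0_ler_powR ?nnegrE ?invr_ge0//.
      by have /andP[] := wge0 p q ip pq qj.
    exact: wle.
have B1 := bd i m m.+1 (leqnn _) im (leqnSn _) mj.
have B2 := bd i m.+1 j (leqnn _) (leqW im) mj (leqnn _).
have -> : rsum f g x i j = rsum f g x i m + f (x m) * (g (x m.+1) - g (x m)) + rsum f g x m.+1 j.
  rewrite /rsum (@big_cat_nat _ _ _ m)//=; last exact: ltnW.
  by rewrite (@big_cat_nat _ _ _ m.+1 m)//= big_nat1 addrA.
set S1 := rsum f g x i m in IH1 *; set S2 := rsum f g x m.+1 j in IH2 *.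
(* Besides the errors of the two halves only two products of increments remain, bounded by [B1] and
   [B2]. *)
have -> : S1 + f (x m) * (g (x m.+1) - g (x m)) + S2 - f (x i) * (g (x j) - g (x i)) =
  (S1 - f (x i) * (g (x m) - g (x i))) + (S2 - f (x m.+1) * (g (x j) - g (x m.+1)))
  + ((f (x m) - f (x i)) * (g (x m.+1) - g (x m))
  + (f (x m.+1) - f (x i)) * (g (x j) - g (x m.+1))) by ring.
rewrite (le_trans (ler_normD _ _))//.
rewrite (le_trans (lerD (ler_normD _ _) (ler_normD _ _)))//.
rewrite (le_trans (lerD (lerD IH1 IH2) (lerD B1 B2)))//.
rewrite le_eqVlt; apply/orP; left; apply/eqP; rewrite /young_const.
set hh := half_powR a; set ww := w `^ _.
have h1 : 1 - 2 * hh != 0 by rewrite gt_eqF// subr_gt0; exact: half_powR_lt.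
by field.
Qed.

(** Increments of order [o((W_v - W_u)^(1/2))]: the product of two of them is [o(W_v - W_u)], hence
    negligible as a local error. *)
Definition half_small W f := forall e, 0 < e -> exists2 d, 0 < d &
  forall u v, 0 <= u -> u <= v -> v <= 1 -> v - u < d ->
  `|f v - f u| <= e * (W v - W u) `^ 2^-1.

(* Interpolation between the modulus of continuity and the [W]-bound. *)
Lemma young_path_half_small W a f : control W -> 2^-1 < a ->
  young_path W a f -> half_small W f.
Proof.
move=> cW a2 [uc [C C0 hC]] e e0.
have a0 : 0 < a by lra.
(* [k] solves [a k = 1/2]: the power [k] of the [W]-bound has exponent [1/2], and the power [1 - k]
   of the modulus of continuity gives the small factor. *)
pose k := (2 * a)^-1.
have k0 : 0 < k by rewrite invr_gt0 mulr_gt0.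
have k1 : 0 < 1 - k by rewrite subr_gt0 invf_lt1 ?mulr_gt0//; lra.
have Ck0 : 0 < C `^ k + 1 by rewrite ltr_wpDl// powR_ge0.
have e1 : 0 < (e / (C `^ k + 1)) `^ (1 - k)^-1 by rewrite powR_gt0// divr_gt0.
have [d d0 hd] := uc _ e1; exists d => // u v u0 uv v1 uvd.
have {}hd := hd u v u0 uv v1 uvd; have {}hC := hC u v u0 uv v1.
have wge := control_sub cW u0 uv v1.
set w := W v - W u in hC wge *.
have h : `|f v - f u| = `|f v - f u| `^ (1 - k) * `|f v - f u| `^ k.
  rewrite -powRD ?subrK ?powRr1 ?oner_eq0//.
rewrite h; apply: le_trans (_ : e / (C `^ k + 1) * (C `^ k * w `^ 2^-1) <= _).
  apply: ler_pM; rewrite ?powR_ge0//.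
    have -> : e / (C `^ k + 1) = ((e / (C `^ k + 1)) `^ (1 - k)^-1) `^ (1 - k).
      by rewrite -powRrM mulVf ?gt_eqF// powRr1 ?ltW ?divr_gt0.
    by apply: ge0_ler_powR; rewrite ?nnegrE ?(ltW k1)// ?powR_ge0.
  rewrite (_ : w `^ 2^-1 = (w `^ a) `^ k); last first.
    by rewrite -powRrM; congr (_ `^ _); rewrite /k; field; rewrite gt_eqF.
  rewrite -powRM ?powR_ge0//.
  by apply: ge0_ler_powR; rewrite ?nnegrE ?(ltW k0)// mulr_ge0// powR_ge0.
rewrite mulrA ler_wpM2r ?powR_ge0// mulrAC ler_pdivrMr//.
by rewrite ler_wpM2l ?(ltW e0)// lerDl.
Qed.

Lemma half_small_prod W f g : control W -> half_small W f -> half_small W g ->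
  small_defect W (fun u v => (f v - f u) * (g v - g u)).
Proof.
move=> cW hf hg e e0.
have [d1 d10 h1] := hf _ e0; have [d2 d20 h2] := hg _ ltr01.
exists (Num.min d1 d2) => [|u v u0 uv v1]; first by rewrite lt_min d10.
rewrite lt_min => /andP[uv1 uv2]; rewrite normrM.
have /andP[w0 _] := control_sub cW u0 uv v1.
rewrite (le_trans (ler_pM _ _ (h1 _ _ u0 uv v1 uv1) (h2 _ _ u0 uv v1 uv2)))//.
have h12 : 2^-1 + 2^-1 = 1 :> R by lra.
have hw := @powRD _ (W v - W u) 2^-1 2^-1.
by rewrite mul1r -mulrA -hw h12 ?oner_eq0// powRr1.
Qed.

(** [d(f g) - f dg - g df] is the product of the two increments, negligible by [half_small_prod]. *)
Lemma dint_parts W f g Y : control W -> half_small W f -> half_small W g ->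
  dint W f g Y -> dint W g f (fun t => f t * g t - Y t).
Proof.
move=> cW hf hg HY.
have HP := half_small_prod cW hf hg.
apply: (small_defect_comb cW ler01 HP HY) => u v _ _ _; rewrite mul1r.
by apply: ler_norm_eqB; ring.
Qed.

End YoungSewing.

(** * Existence of Young integrals *)

Section YoungExistence.
Variable R : realType.
Implicit Types (W f g Y : R -> R) (a A B e t u v : R).

(** Both paths are stopped at [t], so that one partition of [[0, 1]] serves every [t] and the sums
    for different [t] can be compared term by term. *)
Definition stopped_sum f g (n : nat) t : R :=
  rsum (fun s => f (Num.min s t)) (fun s => g (Num.min s t)) (subdiv 0 1 n) 0 n.+1.

Definition clamp u v s : R := Num.max u (Num.min s v).

Lemma clamp_homo u v : {homo clamp u v : s t / s <= t}.
Proof.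
move=> s t st; rewrite /clamp ge_max le_max lexx/= le_max le_min !ge_min st lexx.
by rewrite orbT orbT.
Qed.

(** The difference is 0 unless [u] lies inside the cell. There, inserting [u] as a partition point
    costs one product of increments, of [f] before [u] and of [g] after [u]. *)
Lemma stopped_term_error W f g e m m' u v : control W -> 0 <= e ->
  0 <= m -> m <= m' -> m' <= 1 -> u <= v ->
  (forall p q, m <= p -> p <= q -> q <= m' ->
    `|f q - f p| <= e * (W q - W p) `^ 2^-1 /\
    `|g q - g p| <= e * (W q - W p) `^ 2^-1) ->
  `|f (Num.min m v) * (g (Num.min m' v) - g (Num.min m v)) -
    f (Num.min m u) * (g (Num.min m' u) - g (Num.min m u)) -
    f (clamp u v m) * (g (clamp u v m') - g (clamp u v m))|
   <= e ^+ 2 * (W m' - W m).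
Proof.
move=> cW e0 m0 mm' m'1 uv H.
have /andP[w0 w1] := control_sub cW m0 mm' m'1.
have ew : 0 <= e ^+ 2 * (W m' - W m) by rewrite mulr_ge0// exprn_ge0.
rewrite /clamp; have [m'u|um'] := leP m' u.
  have mu := le_trans mm' m'u; have m'v := le_trans m'u uv; have mv := le_trans mu uv.
  rewrite !(min_l mv) !(min_l m'v) ?(min_l mu) ?(min_l m'u) !(max_l mu) !(max_l m'u).
  by rewrite !subrr mulr0 subr0 normr0.
have [um|mu] := leP u m.
  rewrite ?(min_r um) ?(min_r (ltW um')).
  rewrite !max_r ?le_min ?um ?uv ?(ltW um')//.
  by rewrite !subrr mulr0 subr0 subrr normr0.
have mv := le_trans (ltW mu) uv.
rewrite !(min_l mv) ?(min_l (ltW mu)) ?(min_r (ltW um')) ?(max_l (ltW mu)).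
rewrite max_r ?le_min ?uv ?(ltW um')//.
set q := Num.min m' v.
have qm' : q <= m' by rewrite ge_min lexx.
have uq : u <= q by rewrite le_min uv ltW.
have [h1 _] := H m u (lexx _) (ltW mu) (ltW um').
have [_ h2] := H u q (ltW mu) uq qm'.
have -> : f m * (g q - g m) - f m * (g u - g m) - f u * (g q - g u) =
  - ((f u - f m) * (g q - g u)) by ring.
rewrite normrN normrM.
have [w1a w1b] : 0 <= W u - W m /\ W u - W m <= W m' - W m.
  have := control_sub cW m0 (ltW mu) (le_trans (ltW um') m'1).
  have := control_sub cW (le_trans m0 (ltW mu)) (ltW um') m'1; split; lra.
have [w2a w2b] : 0 <= W q - W u /\ W q - W u <= W m' - W m.
  have := control_sub cW m0 (ltW mu) (le_trans (ltW um') m'1).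
  have := control_sub cW (le_trans m0 (ltW mu)) uq (le_trans qm' m'1).
  have := control_sub cW (le_trans m0 (le_trans (ltW mu) uq)) qm' m'1; split; lra.
have hw := @powRD _ (W m' - W m) 2^-1 2^-1.
have h12 : 2^-1 + 2^-1 = 1 :> R by lra.
rewrite -[W m' - W m]powRr1// -h12 hw; last by rewrite h12 oner_eq0.
rewrite expr2 mulrACA; apply: ler_pM => //.
  by apply: le_trans h1 _; rewrite ler_wpM2l// ge0_ler_powR ?nnegrE ?invr_ge0.
by apply: le_trans h2 _; rewrite ler_wpM2l// ge0_ler_powR ?nnegrE ?invr_ge0.
Qed.

Lemma stopped_sum_sub W f g u v : control W -> half_small W f -> half_small W g ->
  0 <= u -> u <= v -> v <= 1 ->
  forall e, 0 < e -> exists N, forall n, (N <= n)%N ->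
  `|stopped_sum f g n v - stopped_sum f g n u -
    rsum f g (fun k => clamp u v (subdiv 0 1 n k)) 0 n.+1| <= e.
Proof.
move=> cW hf hg u0 uv v1 e e0.
(* [r <= 1] and [r <= e] give [r^2 <= e]. *)
pose r := Num.min 1 e.
have r0 : 0 < r by rewrite lt_min ltr01.
have [d1 d10 h1] := hf _ r0; have [d2 d20 h2] := hg _ r0.
have d0 : 0 < Num.min d1 d2 by rewrite lt_min d10.
have [N HN] := subdiv_mesh ler01 d0; exists N => n /HN; rewrite lt_min => /andP[n1 n2].
pose x := subdiv (0 : R) 1 n.
have xh := @subdiv_homo R 0 1 n ler01.
have x0 k : 0 <= x k by rewrite -(subdiv0 0 1 n) xh.
have x1 k : (k <= n.+1)%N -> x k <= 1 by move=> kn; rewrite -[leRHS](subdiv_end 0 1 n) xh.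
rewrite /stopped_sum /rsum -!sumrB.
apply: le_trans (ler_norm_sum _ _ _) _.
apply: (@le_trans _ _ (\sum_(0 <= k < n.+1) r ^+ 2 * (W (x k.+1) - W (x k)))).
  rewrite big_nat [leRHS]big_nat; apply: ler_sum => k /andP[_ kn].
  apply: stopped_term_error => //; first exact: ltW.
  - exact: xh.
  - exact: x1.
  - move=> p q mp pq qm.
    have pq' : q - p <= (1 - 0) / n.+1%:R.
      by rewrite -(subdiv_incr 0 1 n k); apply: lerB.
    have p0 := le_trans (x0 k) mp; have q1 := le_trans qm (x1 k.+1 kn).
    split.
    + exact: h1 p0 pq q1 (le_lt_trans pq' n1).
    + exact: h2 p0 pq q1 (le_lt_trans pq' n2).
rewrite -mulr_sumr telescope_sumr// /x subdiv_end subdiv0.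
have /andP[w0 w1] := control_sub cW (lexx 0) ler01 (lexx 1).
apply: le_trans (ler_piMr _ w1) _; first by rewrite exprn_ge0// ltW.
rewrite expr2; apply: le_trans (ler_piMr (ltW r0) _) _; rewrite ge_min lexx ?orbT//.
Qed.

Lemma control_powR_half W a u v : control W -> 2^-1 < a -> 0 <= u -> u <= v ->
  v <= 1 -> (W v - W u) `^ a <= (W v - W u) `^ 2^-1.
Proof.
move=> cW a2 u0 uv v1.
by apply: powR_le_exp; [exact: control_sub|rewrite invr_gt0|exact: ltW].
Qed.

(** Compactness of [[-M, M]] gives a cluster point, and a cluster point of an ultrafilter is a
    limit. *)
Lemma bounded_ultra_cvg (T : Type) (U : set_system T) (F : T -> R) (M : R) :
  UltraFilter U -> (forall n, `|F n| <= M) -> exists l : R, F n @[n --> U] --> l.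
Proof.
move=> UU FM.
have UP : ProperFilter U by exact: ultra_proper.
have cM := @segment_compact R (- M) M.
have UF : (F @ U) `[- M, M]%classic.
  by apply: (@filterE _ U) => n /=; rewrite in_itv /= -ler_norml.
have [l [_ cl]] := cM (F @ U) _ UF.
exists l => A Al.
have [//|UA] := in_ultra_setVsetC (F @^-1` A) UU.
by have [x [nAx Ax]] := cl (~` A) A UA Al.
Qed.

(** The integral is a limit of stopped sums along an ultrafilter, which exists by boundedness,
    without a Cauchy estimate. The bound of [young_discrete] does not depend on the partition and
    passes to the limit. Its constants are local to [[u, v]], since [dint] follows by taking [B]
    small on short intervals. *)
Lemma young_integral_exists W a f g : control W -> 2^-1 < a ->
  young_path W a f -> young_path W a g ->
  exists Y, [/\ Y 0 = 0, dint W f g Y &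
    forall A B u v, 0 <= A -> 0 <= B -> 0 <= u -> u <= v -> v <= 1 ->
    (forall p q, u <= p -> p <= q -> q <= v ->
      `|f q - f p| <= A * (W q - W p) `^ a /\
      `|g q - g p| <= B * (W q - W p) `^ 2^-1) ->
    `|Y v - Y u - f u * (g v - g u)| <=
      young_const a * (A * B) * (W v - W u) `^ (a + 2^-1)].
Proof.
move=> cW a2 Vf Vg.
have a0 : 0 < a by lra.
have th0 : 0 < a + 2^-1 by lra.
have hf := young_path_half_small cW a2 Vf; have hg := young_path_half_small cW a2 Vg.
have [ucf [Cf Cf0 hCf]] := Vf; have [ucg [Cg Cg0 hCg]] := Vg.
have K0 := young_const_gt0 a2.
have bound n u v A B : 0 <= A -> 0 <= B -> 0 <= u -> u <= v -> v <= 1 ->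
    (forall p q, u <= p -> p <= q -> q <= v ->
      `|f q - f p| <= A * (W q - W p) `^ a /\
      `|g q - g p| <= B * (W q - W p) `^ 2^-1) ->
    `|rsum f g (fun k => clamp u v (subdiv 0 1 n k)) 0 n.+1 - f u * (g v - g u)| <=
      young_const a * (A * B) * (W v - W u) `^ (a + 2^-1).
  move=> A0 B0 u0 uv v1 H.
  have xu : clamp u v (subdiv 0 1 n 0) = u.
    by rewrite subdiv0 /clamp min_l ?(le_trans u0)// max_l.
  have xv : clamp u v (subdiv 0 1 n n.+1) = v.
    by rewrite subdiv_end /clamp min_r// max_r.
  have := @young_discrete _ W a A B f g u v (fun k => clamp u v (subdiv 0 1 n k)) 0 n.+1.
  rewrite xu xv; apply => // k l kl.
  by apply: clamp_homo; apply: subdiv_homo.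
have Hglob p q : 0 <= p -> p <= q -> q <= 1 ->
      `|f q - f p| <= Cf * (W q - W p) `^ a /\
      `|g q - g p| <= Cg * (W q - W p) `^ 2^-1.
  move=> p0 pq q1; split; first exact: hCf.
  apply: le_trans (hCg _ _ p0 pq q1) _; rewrite ler_wpM2l//.
  exact: control_powR_half.
(* One ultrafilter finer than the filter at infinity is fixed for all [t], so that the limits at [u]
   and at [v] are compared along the same [n]. *)
have [U [UU infU]] := @ultraFilterLemma nat \oo _.
have UP : ProperFilter U by exact: ultra_proper.
have cvgS t : 0 <= t <= 1 -> exists l : R, stopped_sum f g n t @[n --> U] --> l.
  move=> /andP[t0 t1].
  pose M := `|f 0 * (g t - g 0)| + young_const a * (Cf * Cg).
  apply: (@bounded_ultra_cvg _ _ _ M) => // n.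
  have -> : stopped_sum f g n t =
      rsum f g (fun k => clamp 0 t (subdiv 0 1 n k)) 0 n.+1.
    have x0 k : (0 : R) <= subdiv 0 1 n k.
      by rewrite -[leLHS](subdiv0 0 1 n) subdiv_homo.
    apply: eq_bigr => k _; rewrite /clamp !max_r// le_min ?x0//.
  have := bound n 0 t Cf Cg Cf0 Cg0 (lexx _) t0 t1.
  set S := rsum _ _ _ _ _ => /(_ _)/le_trans bS.
  have {}bS : `|S - f 0 * (g t - g 0)| <= young_const a * (Cf * Cg).
    apply: bS => [p q p0 pq qt|]; first by apply: Hglob => //; exact: le_trans t1.
    rewrite ler_piMr ?young_constM_ge0//.
    by apply: powR_le1; [exact: control_sub|exact: ltW].
  rewrite -(subrK (f 0 * (g t - g 0)) S) /M addrC.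
  by rewrite (le_trans (ler_normD _ _))// lerD2l.
pose Y t := lim (stopped_sum f g n t @[n --> U]).
have YE t : 0 <= t <= 1 -> stopped_sum f g n t @[n --> U] --> Y t.
  by move=> /cvgS [l hl]; rewrite /Y (cvg_lim _ hl).
have Ybound A B u v : 0 <= A -> 0 <= B -> 0 <= u -> u <= v -> v <= 1 ->
    (forall p q, u <= p -> p <= q -> q <= v ->
      `|f q - f p| <= A * (W q - W p) `^ a /\
      `|g q - g p| <= B * (W q - W p) `^ 2^-1) ->
    `|Y v - Y u - f u * (g v - g u)| <=
      young_const a * (A * B) * (W v - W u) `^ (a + 2^-1).
  move=> A0 B0 u0 uv v1 H.
  have Yu : stopped_sum f g n u @[n --> U] --> Y u by apply: YE; rewrite u0 (le_trans uv).
  have Yv : stopped_sum f g n v @[n --> U] --> Y v by apply: YE; rewrite v1 (le_trans u0).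
  apply/ler_addgt0Pr => e e0.
  have e3 : 0 < e / 3 by lra.
  move/cvgrPdist_le : Yu => /(_ _ e3) Yu.
  move/cvgrPdist_le : Yv => /(_ _ e3) Yv.
  have [N HN] := stopped_sum_sub cW hf hg u0 uv v1 e3.
  have UN : \forall n \near U, (N <= n)%N by apply: infU; exact: nbhs_infty_ge.
  have [n [[/= nu nv] Nn]] := filter_ex (filterI (filterI Yu Yv) UN).
  have := bound n u v A B A0 B0 u0 uv v1 H; have := HN n Nn.
  set S := rsum _ _ _ _ _; set su := stopped_sum _ _ _ u in nu *.
  set sv := stopped_sum _ _ _ v in nv * => i1 i2.
  have -> : Y v - Y u - f u * (g v - g u) = (Y v - sv) - (Y u - su) +
     ((sv - su - S) + (S - f u * (g v - g u))) by ring.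
  rewrite (le_trans (ler_normD _ _))//.
  rewrite (le_trans (lerD (ler_normB _ _) (ler_normD _ _)))//; lra.
exists Y; split => //.
  apply: (@cvg_lim R) => //.
  rewrite (_ : (fun n => stopped_sum f g n 0) = cst 0); first exact: cvg_cst.
  apply/funext => n; rewrite /stopped_sum /rsum big1// => k _.
  have x0 m : (0 : R) <= subdiv 0 1 n m by rewrite -[leLHS](subdiv0 0 1 n) subdiv_homo.
  by rewrite /= !(min_r (x0 _)) subrr mulr0.
move=> e e0.
(* With this constant in the [1/2]-bound of [g], the Young bound is at most [e (W v - W u)], because
   [a + 1/2 >= 1]. *)
have e1 : 0 < e / (young_const a * (Cf + 1)) by rewrite divr_gt0// mulr_gt0// ltr_wpDl.
have [d d0 hd] := hg _ e1; exists d => // u v u0 uv v1 uvd.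
apply: le_trans (Ybound Cf (e / (young_const a * (Cf + 1))) u v _ _ u0 uv v1 _) _ => //.
- exact: ltW.
- move=> p q up pq qv.
  have p0 := le_trans u0 up; have q1 := le_trans qv v1.
  split; first exact: hCf.
  by apply: hd => //; apply: le_lt_trans uvd; apply: lerB.
have wge := control_sub cW u0 uv v1.
apply: ler_pM; rewrite ?powR_ge0//.
- by apply: young_constM_ge0 => //; exact: ltW.
- have -> : young_const a * (Cf * (e / (young_const a * (Cf + 1)))) = e * (Cf / (Cf + 1)).
    by field; rewrite !gt_eqF// ltr_wpDl.
  by rewrite ler_piMr ?(ltW e0)// ler_pdivrMr ?ltr_wpDl// mul1r lerDl.
- rewrite -[leRHS]powRr1; last by have /andP[] := wge.
  by apply: powR_le_exp => //; lra.
Qed.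

Lemma young_path_bounded W a f : control W -> 0 < a -> young_path W a f ->
  exists2 M, 0 <= M & forall t, 0 <= t <= 1 -> `|f t| <= M.
Proof.
move=> cW a0 [_ [C C0 hC]]; exists (`|f 0| + C); first by rewrite addr_ge0.
move=> t /andP[t0 t1]; rewrite -(subrK (f 0) (f t)) addrC.
rewrite (le_trans (ler_normD _ _))// lerD2l (le_trans (hC _ _ (lexx _) t0 t1))//.
by rewrite ler_piMr// powR_le1 ?(ltW a0)//; exact: control_sub.
Qed.

(** By uniqueness [Y] has the increments of the integral constructed above, whose Young bound gives
    the power [a]; uniform continuity is read off the defect. Hence integrals can be integrated
    again. *)
Lemma dint_young_path W a f g Y : control W -> 2^-1 < a -> a <= 1 ->
  young_path W a f -> young_path W a g -> dint W f g Y -> young_path W a Y.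
Proof.
move=> cW a2 a1 Vf Vg HY.
have a0 : 0 < a by lra.
have [Z [Z0 HZ Zb]] := young_integral_exists cW a2 Vf Vg.
have YZ u v : 0 <= u -> u <= v -> v <= 1 -> Y v - Y u = Z v - Z u.
  by move=> u0 uv v1; exact: dint_sub HY HZ.
have [M M0 fM] := young_path_bounded cW a0 Vf.
have [ucf [Cf Cf0 hCf]] := Vf; have [ucg [Cg Cg0 hCg]] := Vg.
split.
  move=> e e0.
  have e2 : 0 < e / 2 by lra.
  have e1 : 0 < e / (2 * (M + 1)) by rewrite divr_gt0// mulr_gt0// ltr_wpDl.
  have [d1 d10 h1] := HY _ e2; have [d2 d20 h2] := ucg _ e1.
  exists (Num.min d1 d2) => [|u v u0 uv v1]; first by rewrite lt_min d10.
  rewrite lt_min => /andP[uv1 uv2].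
  rewrite -(subrK (f u * (g v - g u)) (Y v - Y u)).
  rewrite (le_trans (ler_normD _ _))// [leRHS]splitr lerD//.
    apply: le_trans (h1 _ _ u0 uv v1 uv1) _; rewrite ler_piMr ?(ltW e2)//.
    by have /andP[] := control_sub cW u0 uv v1.
  rewrite normrM.
  have fu : `|f u| <= M by apply: fM; rewrite u0 (le_trans uv).
  apply: le_trans (ler_pM _ _ fu (h2 _ _ u0 uv v1 uv2)) _ => //.
  rewrite (_ : M * _ = e / 2 * (M / (M + 1))); last by field; rewrite gt_eqF// ltr_wpDl.
  by rewrite ler_piMr ?(ltW e2)// ler_pdivrMr ?ltr_wpDl// mul1r lerDl.
exists (M * Cg + young_const a * (Cf * Cg)).
  by rewrite addr_ge0 ?young_constM_ge0// mulr_ge0.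
move=> u v u0 uv v1; rewrite YZ//.
have wge := control_sub cW u0 uv v1.
rewrite -(subrK (f u * (g v - g u)) (Z v - Z u)) addrC.
rewrite (le_trans (ler_normD _ _))// mulrDl lerD//.
  rewrite normrM -mulrA ler_pM//; last exact: hCg.
  by apply: fM; rewrite u0 (le_trans uv).
apply: le_trans (Zb Cf Cg u v Cf0 Cg0 u0 uv v1 _) _.
  move=> p q up pq qv.
  have p0 := le_trans u0 up; have q1 := le_trans qv v1.
  split; first exact: hCf.
  apply: le_trans (hCg _ _ p0 pq q1) _; rewrite ler_wpM2l//.
  exact: control_powR_half.
rewrite ler_wpM2l ?young_constM_ge0//.
by apply: powR_le_exp => //; lra.
Qed.

(** For a closed integrator the first-order term [f_0 (g_1 - g_0)] vanishes, and only the product of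
    the two Holder constants is left. This makes integrals along closed curves continuous in both
    functions. *)
Lemma dint_total_bound W a f g Y A B : control W -> 2^-1 < a ->
  young_path W a f -> young_path W a g -> dint W f g Y -> g 0 = g 1 ->
  0 <= A -> 0 <= B -> holder W a A f -> holder W a B g ->
  `|Y 1 - Y 0| <= young_const a * (A * B).
Proof.
move=> cW a2 Vf Vg HY g01 A0 B0 fA gB.
have [Z [Z0 HZ Zb]] := young_integral_exists cW a2 Vf Vg.
rewrite (dint_sub cW (lexx 0) ler01 (lexx 1) HY HZ).
have := Zb A B 0 1 A0 B0 (lexx _) ler01 (lexx _).
rewrite g01 subrr mulr0 subr0 => /(_ _)/le_trans; apply.
  move=> p q p0 pq q1; split; first exact: fA.
  apply: le_trans (gB _ _ p0 pq q1) _; rewrite ler_wpM2l//.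
  exact: control_powR_half.
rewrite ler_piMr ?young_constM_ge0// powR_le1//; last by lra.
exact: control_sub.
Qed.

End YoungExistence.

(** * Iterated integrals *)

Section IteratedIntegrals.
Variable R : realType.
Implicit Types (W : R -> R) (a b e t : R).

Lemma mesh_incr a b (s : seq R) k : (k < size s)%N ->
  nth b (a :: s) k.+1 - nth b (a :: s) k <= mesh a b s.
Proof.
by move=> ks; apply: (@bigmax_sup_seq _ _ _ _ _ k) => //; rewrite mem_index_iota.
Qed.

Lemma partition_mesh_lt a b e : a <= b -> 0 < e ->
  exists2 s, itv_partition a b s & mesh a b s < e.
Proof.
rewrite le_eqVlt => /predU1P[->|ab] e0.
  by exists [::]; [split|rewrite /mesh big_geq].
have [N /(_ N (leqnn _)) HN] := subdiv_mesh (ltW ab) e0.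
pose s := mkseq (fun k => subdiv a b N k.+1) N.+1.
have ns k : (k <= N.+1)%N -> nth b (a :: s) k = subdiv a b N k.
  by case: k => [_|k kN] /=; [rewrite subdiv0|rewrite nth_mkseq].
have ss : size s = N.+1 by rewrite size_mkseq.
have step0 : 0 < (b - a) / N.+1%:R by rewrite divr_gt0// subr_gt0.
exists s.
  split.
    apply/(pathP b) => k; rewrite ss => kN.
    have -> : nth b s k = nth b (a :: s) k.+1 by [].
    by rewrite !ns// ?(ltnW kN)// -subr_gt0 subdiv_incr.
  by rewrite (last_nth b) ss ns// subdiv_end.
rewrite /mesh big_nat; apply: bigmax_lt => // k; rewrite ss => kN.
by rewrite !ns ?subdiv_incr// ltnW.
Qed.

Lemma mesh_to0_filter a b : Filter (mesh_to0 a b).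
Proof.
apply: within_filter; apply: filter_from_filter; first by exists 1 => /=.
move=> e f /= e0 f0; exists (Num.min e f); first by rewrite /= lt_min e0.
by move=> s /=; rewrite lt_min => /andP[].
Qed.

Lemma mesh_to0_proper a b : a <= b -> ProperFilter (mesh_to0 a b).
Proof.
move=> ab; apply: Build_ProperFilter_ex; last exact: mesh_to0_filter.
move=> P [e /= e0 he].
have [s ps ms] := partition_mesh_lt ab e0.
by exists s; exact: he ms ps.
Qed.

(** The link with the limit over partitions: over a partition of mesh below [d], the defects of [Y]
    add up to at most [e / 2]. *)
Lemma young_integral_entry W (m n : nat) (phi : R -> 'rV[R]_m) (psi : R -> 'rV[R]_n)
    (Y : 'I_m -> 'I_n -> R -> R) t : control W -> 0 <= t <= 1 ->
  (forall c j, dint W (fun u => phi u 0 c) (fun u => psi u 0 j) (Y c j)) ->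
  forall c j, young_integral 0 t phi psi 0 (mxvec_index c j) = Y c j t - Y c j 0.
Proof.
move=> cW /andP[t0 t1] HY.
have PF := mesh_to0_proper t0; have FF := mesh_to0_filter 0 t.
pose L : 'rV[R]_(m * n) := mxvec (\matrix_(c, j) (Y c j t - Y c j 0)).
suff cvgL : young_sum 0 t phi psi s @[s --> mesh_to0 0 t] --> L.
  by move=> c j; rewrite /young_integral (cvg_lim _ cvgL) ?mxvecE ?mxE//.
have entry c j e : 0 < e -> \forall s \near mesh_to0 0 t,
    `|L 0 (mxvec_index c j) - young_sum 0 t phi psi s 0 (mxvec_index c j)| < e.
  move=> e0; have e2 : 0 < e / 2 by lra.
  have [d d0 hd] := HY c j _ e2.
  exists d => //= s ms [ps ls].
  have part : itv_partition 0 t s by split.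
  have inI k : (k <= size s)%N -> 0 <= nth t (0 :: s) k <= t.
    by move=> ks; rewrite itv_partition_nth_ge// itv_partition_nth_le.
  have incr k : (k < size s)%N -> nth t (0 :: s) k <= nth t (0 :: s) k.+1.
    by move=> ks; apply/ltW; move/(pathP t) : ps; exact.
  pose x k := nth t (0 :: s) k.
  have xE : x (size s) = t by rewrite /x -last_nth (eqP ls).
  have -> : young_sum 0 t phi psi s 0 (mxvec_index c j) =
     \sum_(0 <= k < size s) phi (x k) 0 c * (psi (x k.+1) 0 j - psi (x k) 0 j).
    rewrite /young_sum summxE; apply: eq_bigr => k _.
    by rewrite /tensor mxvecE mxE big_ord1 !mxE.
  rewrite mxvecE mxE.
  have -> : Y c j t - Y c j 0 = \sum_(0 <= k < size s) (Y c j (x k.+1) - Y c j (x k)).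
    by rewrite telescope_sumr// xE.
  rewrite -sumrB.
  apply: (@le_lt_trans _ _ (\sum_(0 <= k < size s) e / 2 * (W (x k.+1) - W (x k)))).
    apply: le_trans (ler_norm_sum _ _ _) _.
    rewrite big_nat [leRHS]big_nat; apply: ler_sum => k /andP[_ ks].
    have /andP[x0 _] := inI _ (ltnW ks); have /andP[_ x1] := inI _ ks.
    apply: hd => //; [exact: incr|exact: le_trans t1|].
    exact: le_lt_trans (mesh_incr 0 t ks) ms.
  rewrite -mulr_sumr telescope_sumr// xE.
  have /andP[w0 w1] := control_sub cW (lexx 0) t0 t1.
  by apply: le_lt_trans (ler_piMr (ltW e2) w1) _; lra.
apply/cvg_ballP => e e0.
have : \forall s \near mesh_to0 0 t, forall cj : 'I_m * 'I_n,
    `|L 0 (mxvec_index cj.1 cj.2) - young_sum 0 t phi psi s 0 (mxvec_index cj.1 cj.2)| < e.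
  by apply: filter_forall => -[c j]; exact: entry.
apply: filterS => s hs; split => // i k.
by rewrite (ord1 i); case/mxvec_indexP: k => c j; exact: (hs (c, j)).
Qed.

Lemma iterated_integral0 (d : nat) (gamma : R -> 'rV[R]_d) k c :
  iterated_integral gamma k 0 0 c = 0.
Proof.
case: k c => [|k] c /=; first by rewrite !mxE subrr.
have PF := @mesh_to0_proper 0 0 (lexx _).
suff h : young_sum 0 0 (iterated_integral gamma k) gamma s
    @[s --> mesh_to0 0 0] --> (0 : 'rV[R]_(tensor_dim d k * d)).
  by rewrite /young_integral (cvg_lim _ h)// mxE.
apply: cvg_near_cst; exists 1 => //= s _ /itv_partitionxx ->.
by rewrite /young_sum big_geq.
Qed.

(** The integral is built by [young_integral_exists] and then identified with the limit over
    partitions. The regularity in degree [k], assumed here, is propagated by [dint_young_path] in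
    the induction that follows. *)
Lemma iterated_integral_step W a (d : nat) (gamma : R -> 'rV[R]_d) k :
  control W -> 2^-1 < a -> (forall j, young_path W a (fun t => gamma t 0 j)) ->
  (forall c, young_path W a (fun t => iterated_integral gamma k t 0 c)) ->
  forall c j, dint W (fun t => iterated_integral gamma k t 0 c)
    (fun t => gamma t 0 j)
    (fun t => iterated_integral gamma k.+1 t 0 (mxvec_index c j)).
Proof.
move=> cW a2 Vg Vk c j.
have /choice[Y HY] : forall cj : 'I_(tensor_dim d k) * 'I_d, exists Y : R -> R,
   Y 0 = 0 /\ dint W (fun t => iterated_integral gamma k t 0 cj.1)
    (fun t => gamma t 0 cj.2) Y.
  by move=> cj; have [Y [? ? _]] := young_integral_exists cW a2 (Vk cj.1) (Vg cj.2);
    exists Y.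
apply: dint_ext (HY (c, j)).2 => // t t01.
rewrite /= (@young_integral_entry W _ _ _ _ (fun c j => Y (c, j)))//.
  by rewrite (HY (c, j)).1 subr0.
by move=> c' j'; exact: (HY (c', j')).2.
Qed.

Lemma iterated_integral_dint W a (d : nat) (gamma : R -> 'rV[R]_d) :
  control W -> 2^-1 < a -> a <= 1 ->
  (forall j, young_path W a (fun t => gamma t 0 j)) ->
  forall k c j, dint W (fun t => iterated_integral gamma k t 0 c)
    (fun t => gamma t 0 j)
    (fun t => iterated_integral gamma k.+1 t 0 (mxvec_index c j)).
Proof.
move=> cW a2 a1 Vg k; apply: (iterated_integral_step cW a2 Vg).
elim: k => [c|k IH c].
  have [uc [C C0 hC]] := Vg c; split.
    move=> e e0; have [r r0 hr] := uc _ e0; exists r => // u v u0 uv v1 uvr.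
    by rewrite /= !mxE opprB addrA subrK; exact: hr.
  by exists C => // u v u0 uv v1; rewrite /= !mxE opprB addrA subrK; exact: hC.
case/mxvec_indexP : c => c j.
exact: dint_young_path cW a2 a1 (IH c) (Vg j) (iterated_integral_step cW a2 Vg IH c j).
Qed.

End IteratedIntegrals.

(** * Functions determined by the signature *)

Section SignatureFunctions.
Variable R : realType.
Implicit Types (W f g h X Y Z : R -> R) (a b c e t : R).

Lemma young_path_cst W a c : control W -> young_path W a (cst c).
Proof.
move=> cW; split; first by move=> e e0; exists 1 => // u v *; rewrite subrr normr0 ltW.
by exists 0 => // u v *; rewrite subrr normr0 mul0r.
Qed.

Lemma young_path_lin W a c f g : young_path W a f -> young_path W a g ->
  young_path W a (fun t => c * f t + g t).
Proof.
move=> [ucf [Cf Cf0 hf]] [ucg [Cg Cg0 hg]].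
have E u v : c * f v + g v - (c * f u + g u) = c * (f v - f u) + (g v - g u) by ring.
split.
  move=> e e0.
  have c0 : 0 < `|c| + 1 by rewrite ltr_wpDl.
  have e1 : 0 < e / (2 * (`|c| + 1)) by rewrite divr_gt0// mulr_gt0.
  have e2 : 0 < e / 2 by lra.
  have [d1 d10 h1] := ucf _ e1; have [d2 d20 h2] := ucg _ e2.
  exists (Num.min d1 d2) => [|u v u0 uv v1]; first by rewrite lt_min d10.
  rewrite lt_min => /andP[uv1 uv2]; rewrite E (le_trans (ler_normD _ _))//.
  rewrite [leRHS]splitr lerD//; last exact: h2.
  rewrite normrM (le_trans (ler_wpM2l _ (h1 _ _ u0 uv v1 uv1)))//.
  have -> : `|c| * (e / (2 * (`|c| + 1))) = e / 2 * (`|c| / (`|c| + 1)).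
    by field; rewrite gt_eqF.
  by rewrite ler_piMr ?(ltW e2)// ler_pdivrMr// mul1r lerDl.
exists (`|c| * Cf + Cg) => [|u v u0 uv v1]; first by rewrite addr_ge0// mulr_ge0.
rewrite E (le_trans (ler_normD _ _))// mulrDl lerD ?hg// normrM -mulrA.
by rewrite ler_wpM2l// hf.
Qed.

Lemma dint_shift W f g g' Y c : (forall t, g' t = g t + c) ->
  dint W f g Y -> dint W f g' Y.
Proof.
move=> gg HY e e0; have [d d0 hd] := HY _ e0; exists d => // u v u0 uv v1 uvd.
by rewrite !gg opprD addrACA subrr addr0; exact: hd.
Qed.

Inductive poly_fun : ('rV[R]_2 -> R) -> Prop :=
| poly_cst c : poly_fun (cst c)
| poly_coord j : poly_fun (fun y => y 0 j)
| poly_add P Q : poly_fun P -> poly_fun Q -> poly_fun (fun y => P y + Q y)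
| poly_mul P Q : poly_fun P -> poly_fun Q -> poly_fun (fun y => P y * Q y).

Section TwoPaths.
Variables (W : R -> R) (a : R) (gamma gamma' : R -> 'rV[R]_2).
Hypotheses (cW : control W) (a2 : 2^-1 < a) (a1 : a <= 1).
Hypotheses (Vg : forall j, young_path W a (fun t => gamma t 0 j))
           (Vg' : forall j, young_path W a (fun t => gamma' t 0 j)).

Let x j t := (gamma t - gamma 0) 0 j.
Let x' j t := (gamma' t - gamma' 0) 0 j.

(* Pairs of functions obtained from [gamma] and [gamma'] by the same recipe. *)
Inductive sigfun : (R -> R) -> (R -> R) -> Prop :=
| sf_cst c : sigfun (cst c) (cst c)
| sf_lin c f f' g g' : sigfun f f' -> sigfun g g' ->
    sigfun (fun t => c * f t + g t) (fun t => c * f' t + g' t)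
| sf_int f f' j Y Y' : sigfun f f' -> dint W f (x j) Y -> dint W f' (x' j) Y' ->
    Y 0 = Y' 0 -> sigfun Y Y'.

(** The span of the constants and the coordinates of the iterated integrals; paired members agree at
    time 1 as soon as the signatures do. [sigfun] has the better closure properties, and
    [sigfun_comb] brings its members back to this span. *)
Inductive sigcomb : (R -> R) -> (R -> R) -> Prop :=
| sc_cst c : sigcomb (cst c) (cst c)
| sc_lin c f f' g g' : sigcomb f f' -> sigcomb g g' ->
    sigcomb (fun t => c * f t + g t) (fun t => c * f' t + g' t)
| sc_sig k i : sigcomb (fun t => iterated_integral gamma k t 0 i)
                       (fun t => iterated_integral gamma' k t 0 i).

Let a0 : 0 < a. Proof. by move: a2; lra. Qed.

Let young_path_center j (h : R -> 'rV[R]_2) : young_path W a (fun t => h t 0 j) ->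
  young_path W a (fun t => (h t - h 0) 0 j).
Proof.
move=> Vh; have := young_path_lin 1 Vh (young_path_cst a (- h 0 0 j) cW).
by congr young_path; apply/funext => t; rewrite !mxE mul1r.
Qed.

Let Vx j : young_path W a (x j). Proof. exact: young_path_center. Qed.
Let Vx' j : young_path W a (x' j). Proof. exact: young_path_center. Qed.

Let x0 j : x j 0 = 0. Proof. by rewrite /x subrr mxE. Qed.
Let x'0 j : x' j 0 = 0. Proof. by rewrite /x' subrr mxE. Qed.

Let dint_center f (h : R -> 'rV[R]_2) j Y : dint W f (fun t => h t 0 j) Y ->
  dint W f (fun t => (h t - h 0) 0 j) Y.
Proof. by apply: dint_shift => t; rewrite !mxE. Qed.

Lemma sigfun_young_path f f' : sigfun f f' -> young_path W a f /\ young_path W a f'.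
Proof.
elim=> {f f'} [c|c f f' g g' _ [Vf Vf'] _ [Vh Vh']|f f' j Y Y' _ [Vf Vf'] HY HY' _].
- by split; exact: young_path_cst.
- by split; exact: young_path_lin.
- by split; [exact: dint_young_path HY|exact: dint_young_path HY'].
Qed.

Lemma sigfun_start f f' : sigfun f f' -> f 0 = f' 0.
Proof. by elim=> // c {}f {}f' g g' _ -> _ ->. Qed.

Lemma sigcomb_start f f' : sigcomb f f' -> f 0 = f' 0.
Proof. by elim=> [//|c {}f {}f' g g' _ -> _ -> //|k i]; rewrite !iterated_integral0. Qed.

Lemma sigcomb_end f f' : (forall k, signature gamma k = signature gamma' k) ->
  sigcomb f f' -> f 1 = f' 1.
Proof.
move=> S; elim=> [//|c {}f {}f' g g' _ -> _ -> //|k i].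
by rewrite -/(signature gamma k) S.
Qed.

Lemma sigcomb_int f f' j : sigcomb f f' ->
  exists Z Z', [/\ sigcomb Z Z', dint W f (x j) Z & dint W f' (x' j) Z'].
Proof.
elim=> {f f'} [c|c f f' g g' _ [Y [Y' [sY HY HY']]] _ [Z [Z' [sZ HZ HZ']]]|k i].
- exists (fun t => c * iterated_integral gamma 0%N t 0 j + cst 0 t),
    (fun t => c * iterated_integral gamma' 0%N t 0 j + cst 0 t); split.
  + by apply: sc_lin; [exact: (@sc_sig 0%N j)|exact: sc_cst].
  + by apply: dint_ext (dint_cst (x j) c cW) => // t _; rewrite addr0.
  + by apply: dint_ext (dint_cst (x' j) c cW) => // t _; rewrite addr0.
- exists (fun t => c * Y t + Z t), (fun t => c * Y' t + Z' t).
  by split; [exact: sc_lin|exact: dint_linl|exact: dint_linl].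
- have H := iterated_integral_dint cW a2 a1 Vg i.
  have H' := iterated_integral_dint cW a2 a1 Vg' i.
  eexists; eexists; split; first exact: (@sc_sig k.+1 (mxvec_index i j)).
  + exact: dint_center.
  + exact: dint_center.
Qed.

Lemma dint_eq f g Y Z : dint W f g Y -> dint W f g Z ->
  forall t, 0 <= t <= 1 -> Y t = Z t + (Y 0 - Z 0).
Proof.
move=> HY HZ t /andP[t0 t1].
by have := dint_sub cW (lexx 0) t0 t1 HY HZ; lra.
Qed.

(** Integration against [x j] maps the span into itself up to a constant. This constant [Y 0 - Z 0]
    is the same for both paths because paired functions start at the same value. *)
Lemma sigfun_comb f f' : sigfun f f' -> exists l l', [/\ sigcomb l l',
  (forall t, 0 <= t <= 1 -> f t = l t) & (forall t, 0 <= t <= 1 -> f' t = l' t)].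
Proof.
elim=> {f f'} [c|c f f' g g' _ [l [l' [sl fl fl']]] _ [m [m' [sm gm gm']]]|
  f f' j Y Y' _ [l [l' [sl fl fl']]] HY HY' YY].
- by exists (cst c), (cst c); split => //; exact: sc_cst.
- exists (fun t => c * l t + m t), (fun t => c * l' t + m' t).
  by split; [exact: sc_lin|move=> t t01; rewrite fl// gm|move=> t t01; rewrite fl'// gm'].
- have [Z [Z' [sZ HZ HZ']]] := sigcomb_int j sl.
  have {}HY : dint W l (x j) Y by exact: dint_ext HY.
  have {}HY' : dint W l' (x' j) Y' by exact: dint_ext HY'.
  exists (fun t => 1 * Z t + cst (Y 0 - Z 0) t), (fun t => 1 * Z' t + cst (Y 0 - Z 0) t).
  split; first exact: (sc_lin 1 sZ (sc_cst _)).
    by move=> t t01; rewrite mul1r /cst; exact: (dint_eq HY HZ).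
  by move=> t t01; rewrite mul1r /cst YY (sigcomb_start sZ); exact: (dint_eq HY' HZ').
Qed.

Lemma sigfun_end f f' : (forall k, signature gamma k = signature gamma' k) ->
  sigfun f f' -> f 1 = f' 1.
Proof.
move=> S /sigfun_comb [l [l' [sl fl fl']]].
by rewrite fl ?fl' ?lexx ?ler01//; exact: sigcomb_end.
Qed.

(* Shuffle product with a single letter, by integration by parts. *)
Lemma sigfun_mul_coord i f f' : sigfun f f' ->
  sigfun (fun t => f t * x i t) (fun t => f' t * x' i t).
Proof.
elim=> {f f'} [c|c f f' g g' _ sf _ sg|f f' j Y Y' sf IH HY HY' YY].
- by apply: sf_int (sf_cst c) (dint_cst (x i) c cW) (dint_cst (x' i) c cW) _; rewrite x0 x'0.
- have := sf_lin c sf sg.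
  by congr sigfun; apply/funext => t; ring.
- have [Vf Vf'] := sigfun_young_path sf.
  have VY := dint_young_path cW a2 a1 Vf (Vx j) HY.
  have VY' := dint_young_path cW a2 a1 Vf' (Vx' j) HY'.
  have [Z [Z0 HZ _]] := young_integral_exists cW a2 VY (Vx i).
  have [Z' [Z'0 HZ' _]] := young_integral_exists cW a2 VY' (Vx' i).
  have sZ : sigfun Z Z'.
    by apply: (sf_int (sf_int sf HY HY' YY) HZ HZ'); rewrite Z0 Z'0.
  have [M M0 xM] := young_path_bounded cW a0 (Vx i).
  have [M' M'0 xM'] := young_path_bounded cW a0 (Vx' i).
  have hs := @young_path_half_small R.
  pose Z1 t := Y t * x i t - Z t; pose Z1' t := Y' t * x' i t - Z' t.
  have P1 : dint W (x i) Y Z1 := dint_parts cW (hs _ _ _ cW a2 VY) (hs _ _ _ cW a2 (Vx i)) HZ.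
  have P2 : dint W (x' i) Y' Z1' := dint_parts cW (hs _ _ _ cW a2 VY') (hs _ _ _ cW a2 (Vx' i)) HZ'.
  have D1 := (dint_assoc Z1 cW M0 xM HY).1 P1.
  have D2 := (dint_assoc Z1' cW M'0 xM' HY').1 P2.
  have sxf : sigfun (fun t => x i t * f t) (fun t => x' i t * f' t).
    by move: IH; congr sigfun; apply/funext => t; rewrite mulrC.
  have sD : sigfun Z1 Z1'.
    by apply: (sf_int sxf D1 D2); rewrite /Z1 /Z1' x0 x'0 Z0 Z'0 !mulr0.
  have := sf_lin 1 sD sZ.
  by congr sigfun; apply/funext => t; rewrite /Z1 /Z1'; ring.
Qed.

Lemma sigfun_mul_poly P f f' : poly_fun P -> sigfun f f' ->
  sigfun (fun t => P (gamma t - gamma 0) * f t) (fun t => P (gamma' t - gamma' 0) * f' t).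
Proof.
move=> pP; elim: pP f f' => {P} [c|j|P Q _ IHP _ IHQ|P Q _ IHP _ IHQ] f f' sf.
- have := sf_lin c sf (sf_cst 0).
  by congr sigfun; apply/funext => t; rewrite addr0.
- by have := sigfun_mul_coord j sf; congr sigfun; apply/funext => t; rewrite mulrC.
- have := sf_lin 1 (IHP _ _ sf) (IHQ _ _ sf).
  by congr sigfun; apply/funext => t; ring.
- have := IHP _ _ (IHQ _ _ sf).
  by congr sigfun; apply/funext => t; ring.
Qed.

Lemma sigfun_poly P : poly_fun P ->
  sigfun (fun t => P (gamma t - gamma 0)) (fun t => P (gamma' t - gamma' 0)).
Proof.
move=> pP; have := sigfun_mul_poly pP (sf_cst 1).
by congr sigfun; apply/funext => t; rewrite mulr1.
Qed.

(** By associativity [P d(int f dx) = (P f) dx], and [P f] is again in [sigfun]. *)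
Lemma sigfun_poly_int P f f' : poly_fun P -> sigfun f f' ->
  exists Z Z', [/\ sigfun Z Z', dint W (fun t => P (gamma t - gamma 0)) f Z &
    dint W (fun t => P (gamma' t - gamma' 0)) f' Z'].
Proof.
move=> pP; have [VP VP'] := sigfun_young_path (sigfun_poly pP).
have [M M0 PM] := young_path_bounded cW a0 VP.
have [M' M'0 PM'] := young_path_bounded cW a0 VP'.
elim=> {f f'} [c|c f f' g g' _ [Y [Y' [sY HY HY']]] _ [Z [Z' [sZ HZ HZ']]]|
  f f' j Y Y' sf _ HY HY' YY].
- by exists (cst 0), (cst 0); split; [exact: sf_cst|exact: dint_null|exact: dint_null].
- exists (fun t => c * Y t + Z t), (fun t => c * Y' t + Z' t).
  by split; [exact: sf_lin|exact: dint_linr|exact: dint_linr].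
- have sPf := sigfun_mul_poly pP sf; have [Vf Vf'] := sigfun_young_path sPf.
  have [Z [Z0 HZ _]] := young_integral_exists cW a2 Vf (Vx j).
  have [Z' [Z'0 HZ' _]] := young_integral_exists cW a2 Vf' (Vx' j).
  exists Z, Z'; split.
  + by apply: (sf_int sPf HZ HZ'); rewrite Z0 Z'0.
  + exact: (dint_assoc _ cW M0 PM HY).2.
  + exact: (dint_assoc _ cW M'0 PM' HY').2.
Qed.

(** By uniqueness the integrals may be replaced by a pair in [sigfun], whose members agree at 0 and,
    when the signatures do, at 1. *)
Lemma poly_int_eq P Q Z Z' : (forall k, signature gamma k = signature gamma' k) ->
  poly_fun P -> poly_fun Q ->
  dint W (fun t => P (gamma t - gamma 0)) (fun t => Q (gamma t - gamma 0)) Z ->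
  dint W (fun t => P (gamma' t - gamma' 0)) (fun t => Q (gamma' t - gamma' 0)) Z' ->
  Z 1 - Z 0 = Z' 1 - Z' 0.
Proof.
move=> S pP pQ HZ HZ'.
have [Y [Y' [sY HY HY']]] := sigfun_poly_int pP (sigfun_poly pQ).
rewrite (dint_sub cW (lexx 0) ler01 (lexx 1) HZ HY).
rewrite (dint_sub cW (lexx 0) ler01 (lexx 1) HZ' HY').
by rewrite (sigfun_end S sY) (sigfun_start sY).
Qed.

End TwoPaths.

End SignatureFunctions.

(** * Polynomial approximation in the Lipschitz norm *)

Section LipschitzApproximation.
Variable R : realType.
Implicit Types (e M A B C : R).

Lemma abs_poly_unit e : 0 < e -> exists q : {poly R},
  forall x, `|x| <= 1 -> `| `|x| - q.[x]| <= e.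
Proof.
move=> e0.
(* The classical iteration [r_(n+1) = r_n + (x^2 - r_n^2) / 2], which increases to [|x|] on
   [[-1, 1]]. *)
pose r n : {poly R} := iter n (fun p => p + 2^-1 *: ('X^2 - p ^+ 2)) 0.
have rS n x : (r n.+1).[x] = (r n).[x] + (x ^+ 2 - (r n).[x] ^+ 2) / 2.
  by rewrite /r iterS -/(r n) !hornerE mulrC.
have H n x : `|x| <= 1 -> 0 <= (r n).[x] /\ 0 <= `|x| - (r n).[x] <= 2 / n.+2%:R.
  move=> x1; elim: n => [|n [r0 /andP[e0n en]]].
    by rewrite /r /= horner0 subr0 normr_ge0 divff ?pnatr_eq0.
  rewrite rS -(@real_normK _ x) ?num_real//.
  set s := (r n).[x] in r0 e0n en *; set y := `|x| in x1 e0n en *.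
  have y0 : 0 <= y by exact: normr_ge0.
  have t0 : 0 < 2 / n.+2%:R :> R by rewrite divr_gt0.
  have t1 : 2 / n.+2%:R <= 1 :> R by rewrite ler_pdivrMr// mul1r ler_nat.
  split; first by nra.
  apply/andP; split; first by nra.
  (* The new error is at most [(y - s) (1 - (y - s) / 2)], and [z (1 - z / 2)] increases on
     [[0, 1]]. The last inequality amounts to [(n + 1) (n + 3) <= (n + 2)^2]. *)
  apply: (@le_trans _ _ (2 / n.+2%:R * (1 - (2 / n.+2%:R) / 2))).
    set t := 2 / n.+2%:R in en t0 t1 *.
    have -> : y - (s + (y ^+ 2 - s ^+ 2) / 2) = (y - s) * (1 - (y - s) / 2) - (y - s) * s.
      by field.
    have : 0 <= (t - (y - s)) * (1 - (t + (y - s)) / 2) by rewrite mulr_ge0//; lra.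
    have : 0 <= (y - s) * s by exact: mulr_ge0.
    lra.
  rewrite -[n.+3%:R]natr1 -[n.+2%:R]natr1 -[n.+1%:R]natr1.
  have n0 : 0 <= n%:R :> R by [].
  set k := n%:R in n0 *.
  have k2 : 0 < k + 1 + 1 by lra.
  rewrite ler_pdivlMr; last by lra.
  have -> : 2 / (k + 1 + 1) * (1 - 2 / (k + 1 + 1) / 2) * (k + 1 + 1 + 1) =
     2 * ((k + 1) * (k + 3)) / (k + 2) ^+ 2 by field; rewrite gt_eqF//; lra.
  rewrite ler_pdivrMr; last by rewrite exprn_gt0//; lra.
  by rewrite expr2; nra.
pose n := Num.truncn (2 / e).
exists (r n) => x x1; have [_ /andP[h0 h]] := H n x x1.
rewrite ger0_norm// (le_trans h)// ler_pdivrMr//.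
have : 2 / e < n.+1%:R by exact: truncnS_gt.
rewrite ltr_pdivrMr// => h2; apply: (le_trans (ltW h2)).
by rewrite mulrC ler_wpM2l ?(ltW e0)// ler_nat.
Qed.

Lemma abs_poly M e : 0 < M -> 0 < e -> exists q : {poly R},
  forall x, `|x| <= M -> `| `|x| - q.[x]| <= e.
Proof.
move=> M0 e0; have [q Hq] := abs_poly_unit (divr_gt0 e0 M0).
exists (M *: (q \Po (M^-1 *: 'X))) => x xM.
rewrite hornerZ horner_comp hornerZ hornerX.
have x1 : `|M^-1 * x| <= 1 by rewrite normrM gtr0_norm ?invr_gt0// mulrC ler_pdivrMr// mul1r.
have -> : `|x| - M * q.[M^-1 * x] = M * (`|M^-1 * x| - q.[M^-1 * x]).
  by rewrite normrM gtr0_norm ?invr_gt0// mulrBr mulrA mulfV ?gt_eqF// mul1r.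
rewrite normrM (gtr0_norm M0) mulrC -ler_pdivlMr//; exact: Hq.
Qed.

Lemma poly_antiderivative (p : {poly R}) : exists2 Q : {poly R}, Q^`() = p & Q.[0] = 0.
Proof.
exists (\poly_(i < (size p).+1) (p`_i.-1 / i%:R)).
  apply/polyP => i; rewrite coef_deriv coef_poly ltnS /=.
  case: ltnP => [ip|pi]; last by rewrite mul0rn nth_default.
  by rewrite -[LHS]mulr_natr divfK// pnatr_eq0.
by rewrite horner_coef0 coef_poly /= invr0 mulr0.
Qed.

Lemma poly_lipschitz (p : {poly R}) e y z : y <= z ->
  (forall c, y <= c <= z -> `|p^`().[c]| <= e) -> `|p.[z] - p.[y]| <= e * (z - y).
Proof.
rewrite le_eqVlt => /predU1P[->|yz] H; first by rewrite !subrr normr0 mulr0.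
have [c /itvP cyz ->] := poly_mvt p yz.
rewrite normrM [X in _ * X]gtr0_norm ?subr_gt0//.
by rewrite ler_wpM2r ?subr_ge0 ?(ltW yz)// H// !cyz.
Qed.

(** The square makes the positive part continuously differentiable; the positive part itself is no
    limit of polynomials in the Lipschitz norm near 0. *)
Definition sqpos (y : R) : R := Num.max y 0 ^+ 2.

Lemma sqpos_ge0 y : 0 <= sqpos y. Proof. by rewrite exprn_ge0// le_max lexx orbT. Qed.

Lemma sqpos_neg y : y <= 0 -> sqpos y = 0.
Proof. by move=> y0; rewrite /sqpos max_r// expr0n. Qed.

Lemma sqpos_pos y : 0 <= y -> sqpos y = y ^+ 2.
Proof. by move=> y0; rewrite /sqpos max_l. Qed.

(* The derivative [y + |y|] of [sqpos] is approximated uniformly by polynomials. *)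
Lemma sqpos_poly M e : 0 < M -> 0 < e -> exists Q : {poly R},
  forall y z, `|y| <= M -> `|z| <= M ->
    `|(sqpos y - Q.[y]) - (sqpos z - Q.[z])| <= e * `|y - z| /\
    `|sqpos y - Q.[y]| <= e * M.
Proof.
move=> M0 e0; have [q Hq] := abs_poly M0 e0.
have [Q dQ Q0] := poly_antiderivative (q + 'X).
(* On each half line [sqpos] is a polynomial, so the mean value theorem applies to its difference
   with [Q]; across 0 the two estimates are added. *)
have Hpos y z : 0 <= y -> y <= z -> z <= M ->
    `|(sqpos z - Q.[z]) - (sqpos y - Q.[y])| <= e * (z - y).
  move=> y0 yz zM; rewrite !sqpos_pos ?(le_trans y0)//.
  have -> : z ^+ 2 - Q.[z] - (y ^+ 2 - Q.[y]) = ('X^2 - Q).[z] - ('X^2 - Q).[y].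
    by rewrite !hornerE.
  apply: poly_lipschitz => // c /andP[yc cz].
  have c0 := le_trans y0 yc.
  rewrite derivB derivXn dQ !hornerE /=.
  have := Hq c; rewrite (ger0_norm c0) => /(_ (le_trans cz zM)) h.
  by move: h; congr (`|_| <= _); ring.
have Hneg y z : z <= 0 -> y <= z -> - M <= y ->
    `|(sqpos z - Q.[z]) - (sqpos y - Q.[y])| <= e * (z - y).
  move=> z0 yz My; rewrite !sqpos_neg ?(le_trans yz)// !sub0r.
  have -> : - Q.[z] - - Q.[y] = (- Q).[z] - (- Q).[y] by rewrite !hornerE.
  apply: poly_lipschitz => // c /andP[yc cz].
  have c0 := le_trans cz z0.
  rewrite derivN dQ !hornerE /=.
  have := Hq c; rewrite (ler0_norm c0) => /(_ _) h.
  have {}h : `|- c - q.[c]| <= e by apply: h; rewrite lerNl (le_trans My).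
  by move: h; congr (`|_| <= _); ring.
have Hle y z : y <= z -> `|y| <= M -> `|z| <= M ->
    `|(sqpos z - Q.[z]) - (sqpos y - Q.[y])| <= e * (z - y).
  move=> yz; rewrite [`|y| <= M]ler_norml [`|z| <= M]ler_norml.
  move=> /andP[yM1 yM2] /andP[zM1 zM2].
  have [y0|y0] := leP 0 y; first exact: Hpos.
  have [z0|z0] := leP z 0; first exact: Hneg.
  have h1 := Hpos 0 z (lexx _) (ltW z0) zM2; have h2 := Hneg y 0 (lexx _) (ltW y0) yM1.
  have -> : sqpos z - Q.[z] - (sqpos y - Q.[y]) =
     (sqpos z - Q.[z] - (sqpos 0 - Q.[0])) + (sqpos 0 - Q.[0] - (sqpos y - Q.[y])) by ring.
  rewrite (le_trans (ler_normD _ _))// (le_trans (lerD h1 h2))//.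
  by rewrite -mulrDr subrKA.
have Hall y z : `|y| <= M -> `|z| <= M ->
    `|(sqpos y - Q.[y]) - (sqpos z - Q.[z])| <= e * `|y - z|.
  move=> yM zM; have [yz|/ltW zy] := leP y z.
    by rewrite distrC [`|y - z|]distrC [`|z - y|]ger0_norm ?subr_ge0//; exact: Hle.
  by rewrite [`|y - z|]ger0_norm ?subr_ge0//; exact: Hle.
exists Q => y z yM zM; split; first exact: Hall.
have := Hall y 0 yM; rewrite normr0 => /(_ (ltW M0)).
rewrite Q0 (sqpos_neg (lexx 0)) !subr0 => /le_trans; apply.
by rewrite ler_wpM2l// ltW.
Qed.

(** * Lipschitz norms on boxes and separating functions in the plane *)

Local Notation plane := 'rV[R]_2.
Implicit Types (F G : plane -> R) (y z : plane).

Definition box M y := forall j, `|y 0 j| <= M.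

Definition dist1 y z := \sum_j `|y 0 j - z 0 j|.

Lemma dist1_ge0 y z : 0 <= dist1 y z. Proof. exact: sumr_ge0. Qed.

(** The Lipschitz norm on a box, sup norm included: closeness in this norm makes Young integrals
    along a closed curve close. *)
Definition lip_bound M F C := forall y z, box M y -> box M z ->
  `|F y| <= C /\ `|F y - F z| <= C * dist1 y z.

Lemma lip_bound_le M F A B : A <= B -> lip_bound M F A -> lip_bound M F B.
Proof.
move=> AB H y z yM zM; have [h1 h2] := H y z yM zM; split; first exact: le_trans h1 AB.
by apply: le_trans h2 _; rewrite ler_wpM2r// dist1_ge0.
Qed.

Lemma lip_bound_ext M F G C : F =1 G -> lip_bound M F C -> lip_bound M G C.
Proof. by move=> FG H y z; rewrite -!FG; exact: H. Qed.

Lemma lip_boundD M F G A B : lip_bound M F A -> lip_bound M G B ->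
  lip_bound M (fun y => F y + G y) (A + B).
Proof.
move=> HF HG y z yM zM; have [f1 f2] := HF y z yM zM; have [g1 g2] := HG y z yM zM.
split; first by rewrite (le_trans (ler_normD _ _))// lerD.
rewrite opprD addrACA mulrDl (le_trans (ler_normD _ _))// lerD//.
Qed.

Lemma lip_bound_approx M F G A B : lip_bound M F A ->
  lip_bound M (fun y => F y - G y) B -> lip_bound M G (B + A).
Proof.
move=> HF HD; have HN : lip_bound M (fun y => - (F y - G y)) B.
  move=> y z yM zM; have [h1 h2] := HD y z yM zM.
  by split; [rewrite normrN|rewrite opprK addrC distrC].
by apply: lip_bound_ext (lip_boundD HN HF) => y; ring.
Qed.

(** In the Leibniz splitting of the increment of [F G], both products are bounded by [A B] times the
    distance, whence the factor 2. *)
Lemma lip_boundM M F G A B : lip_bound M F A -> lip_bound M G B ->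
  lip_bound M (fun y => F y * G y) (2 * (A * B)).
Proof.
move=> HF HG y z yM zM; have [f1 f2] := HF y z yM zM; have [g1 g2] := HG y z yM zM.
have [g3 _] := HG z y zM yM.
have A0 := le_trans (normr_ge0 _) f1; have B0 := le_trans (normr_ge0 _) g1.
split.
  rewrite normrM (le_trans (ler_pM _ _ f1 g1))//.
  by rewrite mulr_natl mulr2n lerDl mulr_ge0.
have -> : F y * G y - F z * G z = F y * (G y - G z) + (F y - F z) * G z by ring.
rewrite (le_trans (ler_normD _ _))// !normrM.
rewrite (le_trans (lerD (ler_pM _ _ f1 g2) (ler_pM _ _ f2 g3)))//.
by rewrite le_eqVlt; apply/orP; left; apply/eqP; ring.
Qed.

Lemma lip_bound_poly M F : poly_fun F -> exists2 C, 0 <= C & lip_bound M F C.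
Proof.
elim=> {F} [c|j|P Q _ [A A0 HA] _ [B B0 HB]|P Q _ [A A0 HA] _ [B B0 HB]].
- exists `|c| => // y z _ _; split => //.
  by rewrite subrr normr0 mulr_ge0// dist1_ge0.
- exists (`|M| + 1) => [|y z yM zM]; first by rewrite addr_ge0.
  split; first by rewrite (le_trans (yM j))// (le_trans (ler_norm M))// lerDl.
  rewrite /dist1 (bigD1 j)//=.
  have h : 0 <= \sum_(i < 2 | i != j) `|y 0 i - z 0 i| by exact: sumr_ge0.
  have m0 : 0 <= `|M| by [].
  have d0 : 0 <= `|y 0 j - z 0 j| by [].
  nra.
- by exists (A + B); [exact: addr_ge0|exact: lip_boundD].
- by exists (2 * (A * B)); [rewrite !mulr_ge0|exact: lip_boundM].
Qed.

Definition poly_approx M F := forall e, 0 < e ->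
  exists2 P, poly_fun P & lip_bound M (fun y => F y - P y) e.

Lemma poly_approx_closed M F :
  (forall e, 0 < e -> exists2 G, poly_approx M G & lip_bound M (fun y => F y - G y) e) ->
  poly_approx M F.
Proof.
move=> H e e0; have e2 : 0 < e / 2 by lra.
have [G HG FG] := H _ e2; have [P pP GP] := HG _ e2.
exists P => //; rewrite [e]splitr.
by apply: lip_bound_ext (lip_boundD FG GP) => y; ring.
Qed.

Lemma poly_approx_poly M F : poly_fun F -> poly_approx M F.
Proof.
move=> pF e e0; exists F => // y z _ _; rewrite !subrr normr0.
by split; [exact: ltW|rewrite mulr_ge0 ?dist1_ge0// ltW].
Qed.

Lemma poly_approx_bound M F : poly_approx M F -> exists2 C, 0 <= C & lip_bound M F C.
Proof.
move=> /(_ _ ltr01)[P pP FP]; have [C C0 HC] := lip_bound_poly M pP.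
exists (1 + C); first by rewrite addr_ge0.
by apply: lip_bound_ext (lip_boundD FP HC) => y; rewrite subrK.
Qed.

Lemma poly_approxD M F G : poly_approx M F -> poly_approx M G ->
  poly_approx M (fun y => F y + G y).
Proof.
move=> HF HG e e0; have e2 : 0 < e / 2 by lra.
have [P pP FP] := HF _ e2; have [Q pQ GQ] := HG _ e2.
exists (fun y => P y + Q y); first exact: poly_add.
by rewrite [e]splitr; apply: lip_bound_ext (lip_boundD FP GQ) => y; ring.
Qed.

Lemma poly_approxM M F G : poly_approx M F -> poly_approx M G ->
  poly_approx M (fun y => F y * G y).
Proof.
move=> HF HG e e0.
have [A A0 HA] := poly_approx_bound HF; have [B B0 HB] := poly_approx_bound HG.
(* The error of the product is [2 (A r + r (r + B))], at most [2 (A + B + 1) r] because [r <= 1]. *)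
pose r := Num.min 1 (e / (2 * (A + B + 1))).
have AB1 : 0 < A + B + 1 by rewrite ltr_wpDl// addr_ge0.
have r0 : 0 < r by rewrite lt_min ltr01/= divr_gt0// mulr_gt0.
have r1 : r <= 1 by rewrite ge_min lexx.
have re : 2 * ((A + B + 1) * r) <= e.
  rewrite mulrA -ler_pdivlMl ?mulr_gt0// [_ * e]mulrC ge_min lexx orbT//.
have [P pP FP] := HF _ r0; have [Q pQ GQ] := HG _ r0.
exists (fun y => P y * Q y); first exact: poly_mul.
have HQ := lip_bound_approx HB GQ.
have := lip_boundD (lip_boundM HA GQ) (lip_boundM FP HQ).
move=> /(@lip_bound_ext _ _ (fun y => F y * G y - P y * Q y)) H.
apply: lip_bound_le (H _) => [|y]; last by ring.
by apply: le_trans re; nra.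
Qed.

Lemma poly_approx_cst M c : poly_approx M (cst c).
Proof. exact/poly_approx_poly/poly_cst. Qed.

Lemma poly_approx_horner M F (p : {poly R}) : poly_approx M F ->
  poly_approx M (fun y => p.[F y]).
Proof.
move=> HF; elim/poly_ind: p => [|p c IH].
  rewrite (_ : (fun _ => _) = cst 0); first exact: poly_approx_cst.
  by apply/funext => y; rewrite horner0.
rewrite (_ : (fun _ => _) = (fun y => p.[F y] * F y + cst c y)).
  by apply: poly_approxD (poly_approx_cst _ _); exact: poly_approxM.
by apply/funext => y; rewrite !hornerE.
Qed.

Lemma poly_approx_sqpos M F : poly_approx M F -> poly_approx M (fun y => sqpos (F y)).
Proof.
move=> HF; apply: poly_approx_closed => e e0.
have [C C0 HC] := poly_approx_bound HF.
have C1 : 0 < C + 1 by rewrite ltr_wpDl.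
have [Q HQ] := sqpos_poly C1 (divr_gt0 e0 C1).
exists (fun y => Q.[F y]); first exact: poly_approx_horner.
move=> y z yM zM; have [f1 f2] := HC y z yM zM; have [f3 _] := HC z y zM yM.
have fy : `|F y| <= C + 1 by rewrite (le_trans f1)// lerDl.
have fz : `|F z| <= C + 1 by rewrite (le_trans f3)// lerDl.
have [h1 h2] := HQ _ _ fy fz.
split; first by rewrite (le_trans h2)// divfK// gt_eqF.
apply: le_trans h1 _; apply: le_trans (ler_wpM2l _ f2) _; first by rewrite divr_ge0// ltW.
rewrite mulrA ler_wpM2r ?dist1_ge0// mulrAC ler_pdivrMr// ler_wpM2l ?(ltW e0)// lerDl//.
Qed.

(** Around each point [y] of [K] sits a bump [sqpos (r^2 - |z - y|^2)] that vanishes on [L].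
    Finitely many of them, rescaled, add up to at least 1 on [K], and a truncation makes the value
    exactly 1. *)
Lemma compact_closed_separation (K L : set plane) : compact K -> closed L ->
  (forall y, K y -> ~ L y) ->
  exists chi : plane -> R, [/\ forall M, poly_approx M chi,
    forall y, K y -> chi y = 1 & forall y, L y -> chi y = 0].
Proof.
move=> cK cL KL.
pose good chi := [/\ forall M, poly_approx M chi, forall y, 0 <= chi y &
  forall y, L y -> chi y = 0].
suff [chi [ac c0 cL0] chiK] : exists2 chi, good chi & forall y, K y -> 1 <= chi y.
  (* [1 - sqpos (1 - chi)] equals 1 where [chi >= 1] and 0 where [chi = 0]. *)
  exists (fun y => 1 + (-1) * sqpos (1 + (-1) * chi y)); split.
  - move=> M.
    apply: poly_approxD; first exact: poly_approx_cst.
    apply: poly_approxM; first exact: poly_approx_cst.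
    apply: poly_approx_sqpos; apply: poly_approxD; first exact: poly_approx_cst.
    by apply: poly_approxM => //; exact: poly_approx_cst.
  - by move=> y Ky; rewrite sqpos_neg ?mulr0 ?addr0// mulN1r subr_le0 chiK.
  - by move=> y Ly; rewrite cL0// mulr0 addr0 sqpos_pos// expr1n mulr1 subrr.
(* The filter of good functions under domination: a sum dominates both summands, so compactness of
   [K] yields a single good function that is at least 1 on all of [K]. *)
pose dom : set_system (plane -> R) :=
  filter_from good (fun f => [set h | good h /\ forall y, f y <= h y]).
have goodD f g : good f -> good g -> good (fun y => f y + g y).
  move=> [af f0 fL] [ag g0 gL]; split.
  - by move=> M; exact: poly_approxD.
  - by move=> y; exact: addr_ge0.
  - by move=> y Ly; rewrite fL// gL// addr0.
have Fdom : Filter dom.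
  apply: filter_from_filter.
    by exists (cst 0); split => // M; exact: poly_approx_cst.
  move=> f g gf gg; exists (fun y => f y + g y); first exact: goodD.
  have [_ f0 _] := gf; have [_ g0 _] := gg.
  move=> h [gh fh]; split; split => // y; apply: le_trans (fh y).
    by rewrite lerDl.
  by rewrite lerDr.
have := (compact_near_coveringP K).1 cK _ dom (fun h y => 1 <= h y) Fdom.
case=> [y Ky|f gf /(_ f)]; last first.
  by move=> h; exists f => //; apply: h; split.
have : nbhs y (~` L).
  by apply: open_nbhs_nbhs; split; [exact: closed_openC|exact: KL].
move=> /nbhs_ballP[r /= r0 rL].
pose q z := \sum_j (z 0 j - y 0 j) ^+ 2.
have qE z : q z = (z 0 0 - y 0 0) ^+ 2 + (z 0 1 - y 0 1) ^+ 2.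
  rewrite /q big_ord_recl big_ord1.
  by congr ((z 0 _ - y 0 _) ^+ 2 + (z 0 _ - y 0 _) ^+ 2); exact/val_inj.
(* [s] is the value of [sqpos] at [r^2 / 2]: on the sup norm ball of radius [r / 2],
   [q <= 2 (r / 2)^2 = r^2 / 2]. *)
pose s := (r ^+ 2 / 2) ^+ 2.
have r20 : 0 < r ^+ 2 by rewrite exprn_gt0.
have s0 : 0 < s by rewrite exprn_gt0// divr_gt0.
pose h z := s^-1 * sqpos (r ^+ 2 + (-1) * q z).
have gh : good h.
  split.
  - move=> M; apply: poly_approxM; first exact: poly_approx_cst.
    apply: poly_approx_sqpos; apply: poly_approxD; first exact: poly_approx_cst.
    apply: poly_approxM; first exact: poly_approx_cst.
    apply: poly_approx_poly.
    have pc j : poly_fun (fun z : plane => (z 0 j + cst (- y 0 j) z) * (z 0 j + cst (- y 0 j) z)).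
      by apply: poly_mul; apply: poly_add; (exact: poly_coord || exact: poly_cst).
    have := poly_add (pc 0) (pc 1).
    by congr poly_fun; apply/funext => z; rewrite qE !expr2.
  - by move=> z; rewrite mulr_ge0 ?sqpos_ge0// invr_ge0 ltW.
  - move=> z Lz; rewrite /h sqpos_neg ?mulr0//.
    rewrite mulN1r subr_le0 leNgt; apply/negP => qr.
    apply: (rL z) => //; split => // i j; rewrite (ord1 i).
    rewrite /ball /= -(@ltr_pXn2r _ 2) ?nnegrE ?(ltW r0)//.
    apply: le_lt_trans qr; rewrite /q real_normK ?num_real// -sqrrN opprB.
    by rewrite (bigD1 j)//= lerDl sumr_ge0// => k _; exact: sqr_ge0.
have hball z : ball y (r / 2) z -> 1 <= h z.
  move=> [_ yz].
  have qz : q z <= r ^+ 2 / 2.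
    have c j : (z 0 j - y 0 j) ^+ 2 <= r ^+ 2 / 4.
      have := yz 0 j; rewrite /ball /= distrC => /ltW yzj.
      have -> : r ^+ 2 / 4 = (r / 2) ^+ 2 by rewrite expr_div_n; congr (_ / _); ring.
      by rewrite -[leLHS]real_normK ?num_real// lerXn2r// nnegrE// ltW// divr_gt0.
    have c0 := c 0; have c1 := c 1.
    by rewrite qE; lra.
  rewrite /h mulrC ler_pdivlMr// mul1r sqpos_pos; last by rewrite mulN1r; lra.
  rewrite /s lerXn2r ?nnegrE ?mulN1r//; lra.
exists (ball y (r / 2), [set f | good f /\ forall z, h z <= f z]).
  split; last by exists h.
  by apply: nbhsx_ballx; rewrite divr_gt0.
by move=> [z f] /= [zb [_ hf]]; exact: le_trans (hball _ zb) (hf z).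
Qed.

End LipschitzApproximation.

(** * Controls and integrals of Lipschitz functions *)

Section Controls.
Variable R : realType.
Implicit Types (W V : R -> R) (a e p t u v : R).

Lemma continuous_unif_cont01 (f : R -> R) :
  {within `[0, 1], continuous f} -> unif_cont01 f.
Proof.
move=> cf e e0; have e2 : 0 < e / 2 by lra.
pose P (d u : R) := 0 <= u <= 1 -> forall v, 0 <= v <= 1 -> `|v - u| < d -> `|f v - f u| <= e.
have := (compact_near_coveringP `[0 : R, 1]%classic).1 (@segment_compact _ 0 1).
move=> /(_ _ (0 : R)^'+ P _).
case=> [x x01|d /= d0 hd].
  have /subspace_continuousP/(_ _ x01)/cvgrPdist_lt/(_ _ e2) := cf.
  rewrite near_withinE /= => /nbhs_ballP[r /= r0 hr].
  have r2 : 0 < r / 2 by lra.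
  exists (ball x (r / 2), [set d | d < r / 2]).
    split; first exact: nbhsx_ballx.
    by exists (r / 2) => //= y; rewrite /ball_ /= sub0r normrN => + y0; rewrite gtr0_norm.
  move=> [u d] /= [xu dr] u01 v v01 vud.
  have h1 : `|f x - f u| < e / 2.
    apply: hr; last by rewrite /= in_itv.
    by apply: lt_trans xu _; lra.
  have h2 : `|f x - f v| < e / 2.
    apply: hr; last by rewrite /= in_itv.
    rewrite /ball /= in xu *; rewrite -(subrK u x) -addrA.
    rewrite (le_lt_trans (ler_normD _ _))// [X in _ + X]distrC; lra.
  rewrite -(subrK (f x) (f v)) -addrA (le_trans (ler_normD _ _))// distrC; lra.
exists (d / 2); first lra.
move=> u v u0 uv v1 uvd.
have hd2 : `[0, 1]%classic `<=` P (d / 2).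
  by apply: hd => /=; [rewrite sub0r normrN gtr0_norm; lra|lra].
have u01 : 0 <= u <= 1 by rewrite u0 (le_trans uv).
have v01 : 0 <= v <= 1 by rewrite v1 (le_trans u0).
apply: (hd2 u _ u01 v v01); first by rewrite /= in_itv.
by rewrite ger0_norm ?subr_ge0.
Qed.

Lemma enorm_ge0 (d : nat) (x : 'rV[R]_d) : 0 <= enorm x.
Proof. exact: sqrtr_ge0. Qed.

Lemma entry_le_enorm (d : nat) (x : 'rV[R]_d) j : `|x 0 j| <= enorm x.
Proof.
rewrite -sqrtr_sqr /enorm ler_wsqrtr// (bigD1 j)//= lerDl.
by apply: sumr_ge0 => i _; exact: sqr_ge0.
Qed.

Lemma pvariation_rcons (d : nat) p a u v (gamma : R -> 'rV[R]_d) (s : seq R) :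
  last a s = u ->
  pvariation p a v gamma (rcons s v) =
  pvariation p a u gamma s + enorm (gamma v - gamma u) `^ p.
Proof.
have sumS (F : nat -> R) n : \sum_(0 <= k < n.+1) F k = \sum_(0 <= k < n) F k + F n.
  by rewrite big_nat_recr.
move=> lu; rewrite /pvariation size_rcons sumS.
have n1 k : (k <= size s)%N -> nth v (a :: rcons s v) k = nth u (a :: s) k.
  by move=> ks; rewrite -rcons_cons nth_rcons ltnS ks; apply: set_nth_default.
have n2 : nth v (a :: rcons s v) (size s).+1 = v.
  by rewrite -rcons_cons nth_rcons ltnn eqxx.
have n3 : nth u (a :: s) (size s) = u by rewrite -[RHS]lu -last_nth.
rewrite n2 (n1 _ (leqnn _)) n3.
apply: (f_equal2 +%R _ erefl); apply: eq_big_nat => k /andP[_ ks].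
by rewrite (n1 _ (ltnW ks)) (n1 _ ks).
Qed.

(** [V t] is the [p]-variation over [[0, t]]: appending [v] to a partition of [[0, u]] adds one
    term, so [V] grows by at least that term. *)
Lemma pvariation_control (d : nat) p (gamma : R -> 'rV[R]_d) : p != 0 ->
  finite_pvariation p 0 1 gamma ->
  exists V, forall u v, 0 <= u -> u <= v -> v <= 1 ->
    enorm (gamma v - gamma u) `^ p <= V v - V u.
Proof.
move=> p0 [M ubM].
pose E t := pvariation p 0 t gamma @` [set s | itv_partition 0 t s].
have ext u v s : u < v -> itv_partition 0 u s -> itv_partition 0 v (rcons s v).
  move=> uv [ps /eqP ls]; split; last by rewrite last_rcons.
  by rewrite rcons_path ps ls.
have E0 t : 0 <= t -> E t !=set0.
  rewrite le_eqVlt => /predU1P[<-|t0].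
    by exists (pvariation p 0 0 gamma [::]); exists [::] => //; split.
  by exists (pvariation p 0 t gamma [:: t]); exists [:: t] => //; exact: itv_partition1.
(* A partition of [[0, t]] is extended by the point 1 to one of [[0, 1]], so [M] bounds its sum
   too. *)
have Eub t : t <= 1 -> has_ubound (E t).
  rewrite le_eqVlt => /predU1P[->|t1]; first by exists M.
  exists M => _ [s ps <-].
  have : pvariation p 0 1 gamma (rcons s 1) <= M.
    by apply: ubM; exists (rcons s 1) => //; exact: ext ps.
  rewrite (@pvariation_rcons _ _ _ t); last by case: ps => _ /eqP.
  by apply: le_trans; rewrite lerDl powR_ge0.
exists (fun t => sup (E t)) => u v u0; rewrite le_eqVlt => /predU1P[<- _|uv v1].
  rewrite !subrr (_ : enorm 0 = 0) ?powR0//.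
  by rewrite /enorm big1 ?sqrtr0// => i _; rewrite mxE expr0n.
rewrite lerBrDr addrC -lerBrDr; apply: ge_sup; first exact: E0.
move=> _ [s ps <-]; rewrite lerBrDr.
rewrite -(@pvariation_rcons _ _ 0 u); last by case: ps => _ /eqP.
apply: sup_upper_bound; last by exists (rcons s v) => //; exact: ext ps.
by split; [apply: E0; exact: le_trans (ltW uv)|exact: Eub].
Qed.

Lemma within_coord (A : set R) (d : nat) (gamma : R -> 'rV[R]_d) j :
  {within A, continuous gamma} -> {within A, continuous (fun t => gamma t 0 j)}.
Proof.
move=> /subspace_continuousP cg; apply/subspace_continuousP => x Ax.
exact: (@cvg_comp _ _ _ gamma (fun M : 'rV[R]_d => M 0 j) _ _ _
  (cg x Ax) (@coord_continuous _ _ _ _ _ _)).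
Qed.

Lemma controlled_young_path W V (c : R) (d : nat) p (gamma : R -> 'rV[R]_d) :
  0 < p -> control W -> 0 <= c -> {within `[0, 1], continuous gamma} ->
  (forall u v, 0 <= u -> u <= v -> v <= 1 ->
    enorm (gamma v - gamma u) `^ p <= V v - V u) ->
  (forall u v, 0 <= u -> u <= v -> v <= 1 -> V v - V u <= c * (W v - W u)) ->
  forall j, young_path W p^-1 (fun t => gamma t 0 j).
Proof.
move=> p0 cW c0 cg HV VW j; split.
  by apply: continuous_unif_cont01; exact: within_coord.
exists (c `^ p^-1) => [|u v u0 uv v1]; first exact: powR_ge0.
have /andP[w0 _] := control_sub cW u0 uv v1.
rewrite -powRM//.
have -> : gamma v 0 j - gamma u 0 j = (gamma v - gamma u) 0 j by rewrite !mxE.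
apply: le_trans (entry_le_enorm _ _) _.
rewrite -[leLHS]powRr1 ?enorm_ge0// -(divff (lt0r_neq0 p0)) powRrM.
apply: ge0_ler_powR; rewrite ?nnegrE ?invr_ge0 ?powR_ge0 ?(ltW p0)//.
  by rewrite mulr_ge0.
by apply: le_trans (HV u v u0 uv v1) (VW u v u0 uv v1).
Qed.

(** The sum of the two variation functions, rescaled to mass at most 1, dominates both. A single
    control is wanted because [sigfun] treats the two curves in parallel. *)
Lemma common_control (d : nat) p (gamma gamma' : R -> 'rV[R]_d) : 0 < p ->
  {within `[0, 1], continuous gamma} -> {within `[0, 1], continuous gamma'} ->
  finite_pvariation p 0 1 gamma -> finite_pvariation p 0 1 gamma' ->
  exists W, [/\ control W,
    forall j, young_path W p^-1 (fun t => gamma t 0 j) &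
    forall j, young_path W p^-1 (fun t => gamma' t 0 j)].
Proof.
move=> p0 cg cg' fg fg'.
have [V HV] := pvariation_control (lt0r_neq0 p0) fg.
have [V' HV'] := pvariation_control (lt0r_neq0 p0) fg'.
have Vnd u v : 0 <= u -> u <= v -> v <= 1 -> 0 <= V v - V u.
  by move=> u0 uv v1; apply: le_trans (HV u v u0 uv v1); exact: powR_ge0.
have Vnd' u v : 0 <= u -> u <= v -> v <= 1 -> 0 <= V' v - V' u.
  by move=> u0 uv v1; apply: le_trans (HV' u v u0 uv v1); exact: powR_ge0.
pose c := V 1 - V 0 + (V' 1 - V' 0) + 1.
have c0 : 0 < c.
  have := Vnd 0 1 (lexx _) ler01 (lexx _); have := Vnd' 0 1 (lexx _) ler01 (lexx _).
  by rewrite /c; lra.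
pose W t := (V t + V' t) / c.
have WE u v : c * (W v - W u) = (V v - V u) + (V' v - V' u).
  by rewrite /W; field; rewrite gt_eqF.
have cW : control W.
  split=> [u v u0 uv v1|].
    rewrite ler_pM2r ?invr_gt0//.
    by have := Vnd u v u0 uv v1; have := Vnd' u v u0 uv v1; lra.
  by rewrite -(ler_pM2l c0) WE mulr1 /c; lra.
exists W; split => //; apply: (@controlled_young_path W _ c) => //; rewrite ?(ltW c0)//.
- exact: HV.
- by move=> u v u0 uv v1; rewrite WE lerDl; exact: Vnd'.
- exact: HV'.
- by move=> u v u0 uv v1; rewrite WE lerDr; exact: Vnd.
Qed.

(** [F] changes by at most [C] times the sum of the changes of the two coordinates, whence the
    factor 2. *)
Lemma lip_young_path W a c M C (F : 'rV[R]_2 -> R) (X : R -> 'rV[R]_2) :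
  0 <= c -> 0 <= C -> (forall j, unif_cont01 (fun t => X t 0 j)) ->
  (forall j, holder W a c (fun t => X t 0 j)) ->
  (forall t, 0 <= t <= 1 -> box M (X t)) -> lip_bound M F C ->
  young_path W a (fun t => F (X t)) /\ holder W a (C * (2 * c)) (fun t => F (X t)).
Proof.
move=> c0 C0 ucX hX bX FC.
have dE y z : dist1 y z = `|y 0 0 - z 0 0| + `|y 0 1 - z 0 1| :> R.
  rewrite /dist1 big_ord_recl big_ord1.
  by congr (`|y 0 _ - z 0 _| + `|y 0 _ - z 0 _|); exact/val_inj.
have FX u v : 0 <= u -> u <= v -> v <= 1 ->
    `|F (X v) - F (X u)| <= C * (`|X v 0 0 - X u 0 0| + `|X v 0 1 - X u 0 1|).
  move=> u0 uv v1; rewrite -dE; apply: (FC _ _ _ _).2; apply: bX.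
    by rewrite v1 (le_trans u0).
  by rewrite u0 (le_trans uv).
have H : holder W a (C * (2 * c)) (fun t => F (X t)).
  move=> u v u0 uv v1; apply: le_trans (FX u v u0 uv v1) _.
  rewrite -mulrA ler_wpM2l//.
  have := hX 0 u v u0 uv v1; have := hX 1 u v u0 uv v1; lra.
split => //; split; last by exists (C * (2 * c)); rewrite ?mulr_ge0.
move=> e e0.
have e1 : 0 < e / (2 * (C + 1)) by rewrite divr_gt0// mulr_gt0// ltr_wpDl.
have [d1 d10 h1] := ucX 0 _ e1; have [d2 d20 h2] := ucX 1 _ e1.
exists (Num.min d1 d2) => [|u v u0 uv v1]; first by rewrite lt_min d10.
rewrite lt_min => /andP[uv1 uv2].
apply: le_trans (FX u v u0 uv v1) _.
have := lerD (h1 u v u0 uv v1 uv1) (h2 u v u0 uv v1 uv2).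
move=> /(ler_wpM2l C0)/le_trans; apply.
have -> : C * (e / (2 * (C + 1)) + e / (2 * (C + 1))) = e * (C / (C + 1)).
  by field; rewrite gt_eqF// ltr_wpDl.
by rewrite ler_piMr ?(ltW e0)// ler_pdivrMr ?ltr_wpDl// mul1r lerDl.
Qed.

End Controls.

(** * Equality of the integrals of Lipschitz limits of polynomials *)

Section LipschitzIntegrals.
Variable R : realType.
Variables (W : R -> R) (a : R).
Hypotheses (cW : control W) (a2 : 2^-1 < a) (a1 : a <= 1).

(** [int F dG - int P dQ = int F d(G - Q) + int (F - P) dQ], and along a closed curve
    [dint_total_bound] estimates both integrals. *)
Lemma dint_lip_perturb (c M A B r : R) (F G P Q : 'rV[R]_2 -> R) (X : R -> 'rV[R]_2) Y Z :
  0 <= c -> 0 <= A -> 0 <= B -> 0 <= r -> X 0 = X 1 ->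
  (forall j, unif_cont01 (fun t => X t 0 j)) ->
  (forall j, holder W a c (fun t => X t 0 j)) ->
  (forall t, 0 <= t <= 1 -> box M (X t)) ->
  lip_bound M F A -> lip_bound M Q B ->
  lip_bound M G (r + B) -> lip_bound M P (r + A) ->
  lip_bound M (fun y => F y - P y) r -> lip_bound M (fun y => G y - Q y) r ->
  dint W (fun t => F (X t)) (fun t => G (X t)) Y ->
  dint W (fun t => P (X t)) (fun t => Q (X t)) Z ->
  `|(Y 1 - Y 0) - (Z 1 - Z 0)| <= young_const a * (2 * c) ^+ 2 * (A + B) * r.
Proof.
move=> c0 A0 B0 r0 X01 ucX hX bX FA QB GB PA FP GQ HY HZ.
have LY := @lip_young_path R W a c M _ _ X c0 _ ucX hX bX.
have [VF hF] := LY _ _ A0 FA; have [VQ hQ] := LY _ _ B0 QB.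
have [VG _] := LY _ _ (addr_ge0 r0 B0) GB.
have [VFP hFP] := LY _ _ r0 FP; have [VGQ hGQ] := LY _ _ r0 GQ.
have [T [T0 HT _]] := young_integral_exists cW a2 VF VQ.
have D1 : dint W (fun t => F (X t)) (fun t => G (X t) - Q (X t)) (fun t => -1 * T t + Y t).
  by apply: dint_ext (dint_linr (-1) cW HT HY) => // t _; rewrite mulN1r addrC.
have D2 : dint W (fun t => F (X t) - P (X t)) (fun t => Q (X t)) (fun t => -1 * Z t + T t).
  by apply: dint_ext (dint_linl (-1) cW HZ HT) => // t _; rewrite mulN1r addrC.
have c20 : 0 <= 2 * c by rewrite mulr_ge0.
have b1 := dint_total_bound cW a2 VF VGQ D1 _ (mulr_ge0 A0 c20) (mulr_ge0 r0 c20) hF hGQ.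
have b2 := dint_total_bound cW a2 VFP VQ D2 _ (mulr_ge0 r0 c20) (mulr_ge0 B0 c20) hFP hQ.
rewrite X01 in b1 b2.
have -> : Y 1 - Y 0 - (Z 1 - Z 0) = (-1 * T 1 + Y 1 - (-1 * T 0 + Y 0)) +
  (-1 * Z 1 + T 1 - (-1 * Z 0 + T 0)) by ring.
rewrite (le_trans (ler_normD _ _))// (le_trans (lerD (b1 erefl) (b2 erefl)))//.
by rewrite le_eqVlt; apply/orP; left; apply/eqP; ring.
Qed.

Variables gamma gamma' : R -> 'rV[R]_2.
Hypotheses (Vg : forall j, young_path W a (fun t => gamma t 0 j))
           (Vg' : forall j, young_path W a (fun t => gamma' t 0 j)).
Hypotheses (g01 : gamma 0 = gamma 1) (g01' : gamma' 0 = gamma' 1).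
Hypothesis S : forall k, signature gamma k = signature gamma' k.

(** The sum of the Holder constants serves both coordinates. It also bounds the path, which starts
    at 0, since the control has mass at most 1. *)
Lemma centered_data (h : R -> 'rV[R]_2) : (forall j, young_path W a (fun t => h t 0 j)) ->
  exists c M, [/\ 0 <= c, forall j, unif_cont01 (fun t => (h t - h 0) 0 j),
    forall j, holder W a c (fun t => (h t - h 0) 0 j) &
    forall t, 0 <= t <= 1 -> box M (h t - h 0)].
Proof.
move=> Vh.
have hE u v j : (h v - h 0) 0 j - (h u - h 0) 0 j = h v 0 j - h u 0 j.
  by rewrite !mxE opprB addrA subrK.
have /choice[c Hc] : forall j, exists c, 0 <= c /\ holder W a c (fun t => h t 0 j).
  by move=> j; have [_ [c c0 hc]] := Vh j; exists c.
have hold j : holder W a (\sum_i c i) (fun t => (h t - h 0) 0 j).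
  move=> u v u0 uv v1; rewrite hE; apply: le_trans ((Hc j).2 u v u0 uv v1) _.
  rewrite ler_wpM2r ?powR_ge0// (bigD1 j)//= lerDl.
  by apply: sumr_ge0 => i _; exact: (Hc i).1.
have s0 : 0 <= \sum_i c i by apply: sumr_ge0 => i _; exact: (Hc i).1.
exists (\sum_i c i), (\sum_i c i); split => //.
  move=> j e e0; have [uc _] := Vh j; have [d d0 hd] := uc _ e0.
  by exists d => // u v u0 uv v1 uvd; rewrite hE; exact: hd.
move=> t /andP[t0 t1] j; have := hold j 0 t (lexx _) t0 t1.
rewrite subrr [X in _ - X]mxE subr0 => /le_trans; apply.
rewrite ler_piMr// powR_le1//; first exact: control_sub.
by rewrite (le_trans _ (ltW a2))// invr_ge0.
Qed.

(** Polynomials [r]-close to [F] and [G] have equal integrals along the two curves, and each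
    integral moves by at most a constant times [r]; then [r] is taken small. *)
Lemma lip_int_eq (F G : 'rV[R]_2 -> R) :
  (forall M, poly_approx M F) -> (forall M, poly_approx M G) ->
  exists Y Y', [/\ dint W (fun t => F (gamma t - gamma 0)) (fun t => G (gamma t - gamma 0)) Y,
    dint W (fun t => F (gamma' t - gamma' 0)) (fun t => G (gamma' t - gamma' 0)) Y' &
    Y 1 - Y 0 = Y' 1 - Y' 0].
Proof.
move=> aF aG.
have [c [M [c0 uc hc bM]]] := centered_data Vg.
have [c' [M' [c'0 uc' hc' bM']]] := centered_data Vg'.
pose N := Num.max M M'.
have bN t : 0 <= t <= 1 -> box N (gamma t - gamma 0).
  by move=> /bM b j; rewrite (le_trans (b j))// le_max lexx.
have bN' t : 0 <= t <= 1 -> box N (gamma' t - gamma' 0).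
  by move=> /bM' b j; rewrite (le_trans (b j))// le_max lexx orbT.
have [A A0 FA] := poly_approx_bound (aF N).
have [B B0 GB] := poly_approx_bound (aG N).
have LY := @lip_young_path R W a c N _ _ (fun t => gamma t - gamma 0) c0 _ uc hc bN.
have LY' := @lip_young_path R W a c' N _ _ (fun t => gamma' t - gamma' 0) c'0 _ uc' hc' bN'.
have [Y [_ HY _]] := young_integral_exists cW a2 (LY _ _ A0 FA).1 (LY _ _ B0 GB).1.
have [Y' [_ HY' _]] := young_integral_exists cW a2 (LY' _ _ A0 FA).1 (LY' _ _ B0 GB).1.
exists Y, Y'; split => //; apply/eqP; rewrite -subr_eq0 -normr_eq0; apply/eqP.
apply/le_anti/andP; split => //; apply/ler_addgt0Pr => e e0; rewrite add0r.
have K0 := young_const_gt0 a2.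
pose K := young_const a * ((2 * c) ^+ 2 + (2 * c') ^+ 2) * (A + (1 + B)) + 1.
have AB0 : 0 <= A + (1 + B) by rewrite !addr_ge0.
have K1 : 0 < K.
  by rewrite ltr_wpDl// mulr_ge0// mulr_ge0 ?(ltW K0)// addr_ge0// exprn_ge0// mulr_ge0.
pose r := Num.min 1 (e / K).
have r0 : 0 < r by rewrite lt_min ltr01/= divr_gt0.
have r1 : r <= 1 by rewrite ge_min lexx.
have [P pP FP] := aF N _ r0; have [Q pQ GQ] := aG N _ r0.
have QB : lip_bound N Q (1 + B).
  by apply: lip_bound_le (lip_bound_approx GB GQ); rewrite lerD2r.
have PA := lip_bound_approx FA FP.
have GB' : lip_bound N G (r + (1 + B)).
  by apply: lip_bound_le GB; rewrite addrA lerDr addr_ge0// ltW.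
have B10 : 0 <= 1 + B by rewrite addr_ge0.
have [P0 P00 P0b] := lip_bound_poly N pP; have [Q0 Q00 Q0b] := lip_bound_poly N pQ.
have [Z [_ HZ _]] := young_integral_exists cW a2 (LY _ _ P00 P0b).1 (LY _ _ Q00 Q0b).1.
have [Z' [_ HZ' _]] := young_integral_exists cW a2 (LY' _ _ P00 P0b).1 (LY' _ _ Q00 Q0b).1.
have ZZ := poly_int_eq cW a2 a1 Vg Vg' S pP pQ HZ HZ'.
have c1 := congr1 (fun z => z - gamma 0) g01.
have c1' := congr1 (fun z => z - gamma' 0) g01'.
have d1 := dint_lip_perturb c0 A0 B10 (ltW r0) c1 uc hc bN FA QB GB' PA FP GQ HY HZ.
have d2 := dint_lip_perturb c'0 A0 B10 (ltW r0) c1' uc' hc' bN' FA QB GB' PA FP GQ HY' HZ'.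
have -> : Y 1 - Y 0 - (Y' 1 - Y' 0) = (Y 1 - Y 0 - (Z 1 - Z 0)) - (Y' 1 - Y' 0 - (Z' 1 - Z' 0)).
  by rewrite ZZ; ring.
rewrite (le_trans (ler_normB _ _))// (le_trans (lerD d1 d2))//.
rewrite -!mulrDl -mulrDr.
apply: (@le_trans _ _ (K * r)); first by rewrite ler_wpM2r ?(ltW r0)// /K lerDl.
by rewrite mulrC -ler_pdivlMr// ge_min lexx orbT.
Qed.

End LipschitzIntegrals.

(** * Jordan curves with the same signature *)

Section JordanCurves.
Variable R : realType.
Implicit Types (gamma : R -> 'rV[R]_2) (a d e s t u v tau : R).

Definition centered gamma t := gamma t - gamma 0.

(** For [v = 1] the point is that of time 0, and injectivity on [[0, 1)] would give [u = 0]. *)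
Lemma jordan_inj gamma u v : jordan_curve gamma -> 0 < u < 1 -> 0 <= v <= 1 ->
  centered gamma u = centered gamma v -> u = v.
Proof.
move=> [_ g01 inj] /andP[u0 u1] /andP[v0 v1] /addIr guv.
have uI : u \in `[0, 1[ by rewrite in_itv /= (ltW u0) u1.
move: v1; rewrite le_eqVlt => /predU1P[v1|v1]; last first.
  by apply: inj => //; rewrite in_itv /= v0 v1.
have : u = 0 by apply: inj; rewrite ?in_itv /= ?lexx ?ltr01// guv v1 g01.
by move=> u0'; rewrite u0' ltxx in u0.
Qed.

Lemma within_centered gamma : {within `[0, 1], continuous gamma} ->
  {within `[0, 1], continuous (centered gamma)}.
Proof.
move=> /subspace_continuousP cg; apply/subspace_continuousP => x x01.
by apply: cvgB; [exact: cg|exact: cvg_cst].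
Qed.

Lemma compact_arc gamma u v : {within `[0, 1], continuous gamma} ->
  0 <= u -> v <= 1 -> compact (centered gamma @` `[u, v]).
Proof.
move=> cg u0 v1; apply: continuous_compact; last exact: segment_compact.
apply: continuous_subspaceW (within_centered cg) => t /=.
by rewrite !in_itv /= => /andP[ut tv]; rewrite (le_trans u0)//= (le_trans tv).
Qed.

Lemma avoid_closed gamma (C : set 'rV[R]_2) t : {within `[0, 1], continuous gamma} ->
  closed C -> 0 <= t <= 1 -> ~ C (centered gamma t) ->
  exists2 d, 0 < d &
    forall u, 0 <= u <= 1 -> `|u - t| < d -> ~ C (centered gamma u).
Proof.
move=> cg cC t01 nC.
have tI : `[0, 1]%classic t by rewrite /= in_itv.
have /subspace_continuousP/(_ _ tI) ct := within_centered cg.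
have nb : nbhs (centered gamma t) (~` C).
  by apply: open_nbhs_nbhs; split => //; exact: closed_openC.
have := ct _ nb; rewrite /= => /nbhs_ballP[d /= d0 hd].
exists d => // u u01 ud; apply: hd; last by rewrite /= in_itv.
by rewrite /ball /= distrC.
Qed.

(** Of the five arcs, the outer two have [f = 0] and the next two have constant [g]; on [[s1, t1]]
    the weight is 1 and the integrator telescopes. *)
Lemma bump_integral (W f g Z : R -> R) s s1 t1 t (c0 c1 : R) : control W ->
  0 <= s -> s <= s1 -> s1 <= t1 -> t1 <= t -> t <= 1 -> dint W f g Z ->
  (forall u, 0 <= u <= s -> f u = 0) -> (forall u, s <= u <= s1 -> g u = c0) ->
  (forall u, s1 <= u <= t1 -> f u = 1) -> (forall u, t1 <= u <= t -> g u = c1) ->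
  (forall u, t <= u <= 1 -> f u = 0) -> Z 1 - Z 0 = c1 - c0.
Proof.
move=> cW s0 ss1 st1 tt1 t1' HZ f0 gc0 f1 gc1 f0'.
have h1 := dint_cst_weight cW (lexx 0) s0 (le_trans ss1 (le_trans st1 (le_trans tt1 t1'))) HZ f0.
have h2 := dint_cst_integrator cW s0 ss1 (le_trans st1 (le_trans tt1 t1')) HZ gc0.
have h3 := dint_cst_weight cW (le_trans s0 ss1) st1 (le_trans tt1 t1') HZ f1.
have h4 := dint_cst_integrator cW (le_trans s0 (le_trans ss1 st1)) tt1 t1' HZ gc1.
have h5 := dint_cst_weight cW (le_trans s0 (le_trans ss1 (le_trans st1 tt1))) t1' (lexx 1) HZ f0'.
rewrite (gc0 s1) ?(gc1 t1) ?lexx ?ss1 ?tt1// in h3.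
by lra.
Qed.

Lemma below_three (x y z : R) : 0 < x -> 0 < y -> 0 < z ->
  exists e, [/\ 0 < e, e < x, e < y & e < z].
Proof.
move=> x0 y0 z0; exists (Num.min x (Num.min y z) / 2).
have : Num.min x (Num.min y z) <= x by rewrite ge_min lexx.
have : Num.min x (Num.min y z) <= y by rewrite !ge_min lexx orbT.
have : Num.min x (Num.min y z) <= z by rewrite !ge_min lexx !orbT.
have : 0 < Num.min x (Num.min y z) by rewrite !lt_min x0 y0.
by move: (Num.min _ _) => e *; split; lra.
Qed.

Lemma chain01 (s s1 t1 t : R) : 0 < s -> s < s1 -> s1 < t1 -> t1 < t -> t < 1 ->
  [/\ 0 < s1, s1 < 1, 0 < t1, t1 < 1 & 0 < t /\ s < 1].
Proof. by move=> *; split; [| | | |split]; lra. Qed.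

Section SameSignature.
Variables (W : R -> R) (a : R) (gamma gamma' : R -> 'rV[R]_2).
Hypotheses (cW : control W) (a2 : 2^-1 < a) (a1 : a <= 1).
Hypotheses (J : jordan_curve gamma) (J' : jordan_curve gamma').
Hypotheses (Vg : forall j, young_path W a (fun t => gamma t 0 j))
           (Vg' : forall j, young_path W a (fun t => gamma' t 0 j)).
Hypothesis S : forall k, signature gamma k = signature gamma' k.

Let X := centered gamma.
Let X' := centered gamma'.

Let cg : {within `[0, 1], continuous gamma}. Proof. by have [] := J. Qed.
Let cg' : {within `[0, 1], continuous gamma'}. Proof. by have [] := J'. Qed.
Let g01 : gamma 0 = gamma 1. Proof. by have [] := J. Qed.
Let g01' : gamma' 0 = gamma' 1. Proof. by have [] := J'. Qed.

Let arcX u v : 0 <= u -> v <= 1 -> compact (X @` `[u, v]).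
Proof. exact: compact_arc. Qed.
Let arcX' u v : 0 <= u -> v <= 1 -> compact (X' @` `[u, v]).
Proof. exact: compact_arc. Qed.

Let closedK (K : set 'rV[R]_2) : compact K -> closed K.
Proof. by apply: compact_closed; exact: norm_hausdorff. Qed.

(* If some point of the second curve is off the first one, then
   [chi dtheta], with [chi = 1] near that point and supported off the first
   curve, integrates to [1] along the second curve and to [0] along the first. *)
Lemma image_sub u : 0 < u < 1 -> exists2 tau, 0 <= tau <= 1 & X' u = X tau.
Proof.
move=> u01; have /andP[u0 u1] := u01.
have [//|no] := pselect (exists2 tau, 0 <= tau <= 1 & X' u = X tau).
exfalso.
pose I := X @` `[0, 1].
have cI : compact I by exact: arcX.
have nI : ~ I (X' u).
  by move=> [tau /= tI Xt]; apply: no; exists tau => //; rewrite in_itv in tI.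
have u01' : 0 <= u <= 1 by rewrite !ltW.
have [r r0 hr] := avoid_closed cg' (closedK cI) u01' nI.
(* Half the width of the arc around [u]: [m < r] keeps it off [I], and the other bounds keep it
   inside [(0, 1)]. *)
have [m [m0 mr mu mu1]] : exists m, [/\ 0 < m, m < r, m < u & m < 1 - u].
  by apply: below_three; rewrite ?subr_gt0.
have [s [s1 [t1 [t [s0 ss1 [st1 tt1 t1'] [s1E t1E]]]]]] : exists s s1 t1 t : R,
    [/\ 0 < s, s < s1, [/\ s1 < t1, t1 < t & t < 1] & s1 = u - m /\ t1 = u + m].
  exists ((u - m) / 2), (u - m), (u + m), ((u + m + 1) / 2).
  by split => //; [lra|lra|split; lra].
have [s10 s11 t10 t11 [t0 s1']] := chain01 s0 ss1 st1 tt1 t1'.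
have [chi [ac chi1 chi0]] : exists chi : 'rV[R]_2 -> R, [/\ forall M, poly_approx M chi,
    forall y, (X' @` `[s1, t1]) y -> chi y = 1 &
    forall y, (I `|` (X' @` `[0, s] `|` X' @` `[t, 1])) y -> chi y = 0].
  apply: compact_closed_separation; first by apply: arcX'; exact: ltW.
    apply: closedU; first exact: closedK.
    by apply: closedU; apply: closedK; apply: arcX'; rewrite ?lexx ?ltW.
  move=> _ [v /= + <-]; rewrite in_itv /= => /andP[v1 v2].
  have v01 : 0 < v < 1 by rewrite (lt_le_trans s10 v1) (le_lt_trans v2 t11).
  move=> [|[[w + wv]|[w + wv]]].
  - apply: hr; first by case/andP: v01 => ? ?; rewrite !ltW.
    by rewrite ltr_norml; apply/andP; split; lra.
  - rewrite /= in_itv /= => /andP[w0 w1].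
    have w01 : 0 <= w <= 1 by rewrite w0 (le_trans w1 (ltW s1')).
    have vw := jordan_inj J' v01 w01 (esym wv).
    by have := le_lt_trans w1 ss1; rewrite -vw ltNge v1.
  - rewrite /= in_itv /= => /andP[w0 w1].
    have w01 : 0 <= w <= 1 by rewrite (le_trans (ltW t0) w0) w1.
    have vw := jordan_inj J' v01 w01 (esym wv).
    by have := lt_le_trans tt1 w0; rewrite -vw ltNge v2.
have [theta [at' theta1 theta0]] : exists theta : 'rV[R]_2 -> R,
    [/\ forall M, poly_approx M theta,
    forall y, (X' @` `[t1, t]) y -> theta y = 1 &
    forall y, (X' @` `[s, s1]) y -> theta y = 0].
  apply: compact_closed_separation; first by apply: arcX'; exact: ltW.
    by apply: closedK; apply: arcX'; exact: ltW.
  move=> _ [v /= + <-]; rewrite in_itv /= => /andP[v1 v2] [w + wv].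
  rewrite /= in_itv /= => /andP[w0 w1].
  have v01 : 0 < v < 1 by rewrite (lt_le_trans t10 v1) (le_lt_trans v2 t1').
  have w01 : 0 <= w <= 1 by rewrite (ltW (lt_le_trans s0 w0)) (ltW (le_lt_trans w1 s11)).
  have vw := jordan_inj J' v01 w01 (esym wv).
  by have := le_lt_trans w1 st1; rewrite -vw ltNge v1.
have [Y [Y' [HY HY' YY]]] := lip_int_eq cW a2 a1 Vg Vg' g01 g01' S ac at'.
have im (h : R -> 'rV[R]_2) p q v : p <= v <= q -> (h @` `[p, q]) (h v).
  by move=> pvq; exists v; rewrite //= in_itv.
have Y0 : Y 1 - Y 0 = 0.
  rewrite (dint_cst_weight (c := 0) cW (lexx 0) ler01 (lexx 1) HY) ?mul0r// => v v01.
  by apply: chi0; left; exact: (im X).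
have Y1 : Y' 1 - Y' 0 = 1 - 0.
  apply: (bump_integral cW (ltW s0) (ltW ss1) (ltW st1) (ltW tt1) (ltW t1') HY') => v hv.
  - by apply: chi0; right; left; exact: (im X').
  - by apply: theta0; exact: (im X').
  - by apply: chi1; exact: (im X').
  - by apply: theta1; exact: (im X').
  - by apply: chi0; right; right; exact: (im X').
by lra.
Qed.

(** The times [s < s1 < t1 < t] of [X'] correspond to [r t < r t1 < r s1 < r s] for [X]. Along [X]
    the same [theta] therefore descends from 1 to 0 across the arc where [chi = 1], and the two
    integrals would be 1 and -1. *)
Lemma no_reversal (r : R -> R) :
  (forall t, 0 < t < 1 -> 0 < r t < 1 /\ X' t = X (r t)) ->
  ~ (forall u v, 0 < u -> u < v -> v < 1 -> r v < r u).
Proof.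
move=> Hr dec.
have [s [s1 [t1 [t [s0 ss1 [st1 tt1 t1']]]]]] : exists s s1 t1 t : R,
    [/\ 0 < s, s < s1 & [/\ s1 < t1, t1 < t & t < 1]].
  by exists (1 / 5), (2 / 5), (3 / 5), (4 / 5); split; [lra|lra|split; lra].
have dec' u v : 0 < u -> u <= v -> v < 1 -> r v <= r u.
  move=> u0; rewrite le_eqVlt => /predU1P[->//|uv] v1; exact/ltW/dec.
have r1 := dec s s1 s0 ss1 (lt_trans st1 (lt_trans tt1 t1')).
have r2 := dec s1 t1 (lt_trans s0 ss1) st1 (lt_trans tt1 t1').
have r3 := dec t1 t (lt_trans s0 (lt_trans ss1 st1)) tt1 t1'.
have [s10 s11 t10 t11 [t0 s1']] := chain01 s0 ss1 st1 tt1 t1'.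
have /andP[rt0 rt1] : 0 < r t < 1 by apply: (Hr t _).1; rewrite t0 t1'.
have /andP[rs0 rs1] : 0 < r s < 1 by apply: (Hr s _).1; rewrite s0 s1'.
(* Both curves are described by times of the first one, where injectivity
   separates all the arcs involved. *)
have times p q (y : 'rV[R]_2) : 0 < p -> p <= q -> q < 1 ->
    (X' @` `[p, q] `|` X @` `[r q, r p]) y ->
    exists2 tau, r q <= tau <= r p & y = X tau.
  move=> p0 pq q1 [[v + <-]|[tau + <-]]; rewrite /= in_itv /= => h.
    have /andP[pv vq] := h.
    have v0 := lt_le_trans p0 pv; have v1 := le_lt_trans vq q1.
    exists (r v); last by apply: (Hr v _).2; rewrite v0 v1.
    by rewrite (dec' v q v0 vq q1) (dec' p v p0 pv v1).
  by exists tau.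
have otimes (y : 'rV[R]_2) :
    ((X' @` `[0, s] `|` X' @` `[t, 1]) `|` (X @` `[0, r t] `|` X @` `[r s, 1])) y ->
    exists2 tau, 0 <= tau <= r t \/ r s <= tau <= 1 & y = X tau.
  have X00 : X 0 = 0 by rewrite /X /centered subrr.
  have X'0 : X' 0 = 0 by rewrite /X' /centered subrr.
  have X'1 : X' 1 = 0 by rewrite /X' /centered -g01' subrr.
  move=> [[[v + <-]|[v + <-]]|[[v + <-]|[v + <-]]]; rewrite /= in_itv /= => h.
  (* Nothing is known about [r] at 0 and 1; there [X'] is at the origin, which [X] visits at time
     0. *)
  - have [v0|v0] := leP v 0.
      exists 0; first by left; rewrite lexx ltW.
      by rewrite X00 -X'0; congr (X' _); apply/le_anti; case/andP: h => -> _; rewrite v0.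
    have vs : v <= s by case/andP: h.
    have [/andP[rv0 rv1] rvE] : 0 < r v < 1 /\ X' v = X (r v).
      by apply: Hr; rewrite v0 (le_lt_trans vs s1').
    by exists (r v) => //; right; rewrite (ltW rv1) andbT; exact: dec' v0 vs s1'.
  - have [v1|v1] := leP 1 v.
      exists 0; first by left; rewrite lexx ltW.
      by rewrite X00 -X'1; congr (X' _); apply/le_anti; case/andP: h => _ ->; rewrite v1.
    have tv : t <= v by case/andP: h.
    have [/andP[rv0 rv1] rvE] : 0 < r v < 1 /\ X' v = X (r v).
      by apply: Hr; rewrite (lt_le_trans t0 tv) v1.
    by exists (r v) => //; left; rewrite (ltW rv0) /=; exact: dec' t0 tv v1.
  - by exists v => //; left.
  - by exists v => //; right.
have arcs p q : 0 < p -> p <= q -> q < 1 -> compact (X' @` `[p, q] `|` X @` `[r q, r p]).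
  move=> p0 pq q1.
  have /andP[rq0 _] : 0 < r q < 1 by apply: (Hr q _).1; rewrite (lt_le_trans p0 pq) q1.
  have /andP[_ rp1] : 0 < r p < 1 by apply: (Hr p _).1; rewrite p0 (le_lt_trans pq q1).
  by apply: compactU; [apply: arcX'|apply: arcX]; exact: ltW.
have [chi [ac chi1 chi0]] : exists chi : 'rV[R]_2 -> R, [/\ forall M, poly_approx M chi,
    forall y, (X' @` `[s1, t1] `|` X @` `[r t1, r s1]) y -> chi y = 1 &
    forall y, ((X' @` `[0, s] `|` X' @` `[t, 1]) `|` (X @` `[0, r t] `|` X @` `[r s, 1])) y ->
    chi y = 0].
  apply: compact_closed_separation; first exact: arcs s10 (ltW st1) t11.
    by apply: closedU; apply: closedU; apply: closedK; (apply: arcX' || apply: arcX);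
      rewrite ?lexx ?ltW.
  move=> y /(times _ _ _ s10 (ltW st1) t11)[tau /andP[h1 h2] ->] /otimes[w hw Xw].
  have tau01 : 0 < tau < 1.
    by rewrite (lt_le_trans (lt_trans rt0 r3) h1) (le_lt_trans h2 (lt_trans r1 rs1)).
  have w01 : 0 <= w <= 1.
    case: hw => /andP[w0 w1]; first by rewrite w0 (le_trans w1 (ltW rt1)).
    by rewrite (le_trans (ltW rs0) w0) w1.
  have tw := jordan_inj J tau01 w01 Xw.
  case: hw => /andP[w0 w1]; first by have := le_lt_trans w1 r3; rewrite -tw ltNge h1.
  by have := lt_le_trans r1 w0; rewrite -tw ltNge h2.
have [theta [at' theta1 theta0]] : exists theta : 'rV[R]_2 -> R,
    [/\ forall M, poly_approx M theta,
    forall y, (X' @` `[t1, t] `|` X @` `[r t, r t1]) y -> theta y = 1 &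
    forall y, (X' @` `[s, s1] `|` X @` `[r s1, r s]) y -> theta y = 0].
  apply: compact_closed_separation; first exact: arcs t10 (ltW tt1) t1'.
    by apply: closedK; exact: arcs s0 (ltW ss1) s11.
  move=> y /(times _ _ _ t10 (ltW tt1) t1')[tau /andP[h1 h2] ->].
  move=> /(times _ _ _ s0 (ltW ss1) s11)[w /andP[w0 w1] Xw].
  have tau01 : 0 < tau < 1.
    by rewrite (lt_le_trans rt0 h1) (le_lt_trans h2 (lt_trans r2 (lt_trans r1 rs1))).
  have w01 : 0 <= w <= 1.
    rewrite (ltW (lt_le_trans (lt_trans rt0 (lt_trans r3 r2)) w0)).
    by rewrite (ltW (le_lt_trans w1 rs1)).
  have tw := jordan_inj J tau01 w01 Xw.
  by have := lt_le_trans r2 w0; rewrite -tw ltNge h2.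
have [Y [Y' [HY HY' YY]]] := lip_int_eq cW a2 a1 Vg Vg' g01 g01' S ac at'.
have im (h : R -> 'rV[R]_2) p q v : p <= v <= q -> (h @` `[p, q]) (h v).
  by move=> pvq; exists v; rewrite //= in_itv.
have Y1 : Y' 1 - Y' 0 = 1 - 0.
  apply: (bump_integral cW (ltW s0) (ltW ss1) (ltW st1) (ltW tt1) (ltW t1') HY') => v hv.
  - by apply: chi0; left; left; exact: (im X').
  - by apply: theta0; left; exact: (im X').
  - by apply: chi1; left; exact: (im X').
  - by apply: theta1; left; exact: (im X').
  - by apply: chi0; left; right; exact: (im X').
have Y0 : Y 1 - Y 0 = 0 - 1.
  apply: (bump_integral cW (ltW rt0) (ltW r3) (ltW r2) (ltW r1) (ltW rs1) HY) => v hv.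
  - by apply: chi0; right; left; exact: (im X).
  - by apply: theta1; right; exact: (im X).
  - by apply: chi1; right; exact: (im X).
  - by apply: theta0; right; exact: (im X).
  - by apply: chi0; right; right; exact: (im X).
by lra.
Qed.

(** [r] is chosen pointwise by [image_sub]. Continuity inside comes from compactness and
    injectivity, monotonicity from continuity and injectivity, and continuity at the end points only
    then, with the help of monotonicity. *)
Lemma reparametrization_exists : exists r : R -> R,
  [/\ {within `[0, 1], continuous r}, {in `[0, 1], forall t, r t \in `[0, 1]},
      {in `[0, 1] &, {homo r : s t / s < t}} &
      {in `[0, 1], forall t, X' t = X (r t)}].
Proof.
have X00 : X 0 = 0 by rewrite /X /centered subrr.
have X1 : X 1 = 0 by rewrite /X /centered -g01 subrr.
have X'0 : X' 0 = 0 by rewrite /X' /centered subrr.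
have X'1 : X' 1 = 0 by rewrite /X' /centered -g01' subrr.
(* Interior times have interior partners: at an interior time [X'] is off the origin, while [X] is
   at the origin at times 0 and 1. *)
have /choice[rho Hrho] : forall u, exists tau, 0 < u < 1 -> 0 < tau < 1 /\ X' u = X tau.
  move=> u; have [u01|nu] := boolP (0 < u < 1); last by exists 0.
  have [tau /andP[t0 t1] Xt] := image_sub u01; exists tau => _; split => //.
  have nz : X tau <> 0.
    rewrite -Xt => Xu; have /andP[u0 _] := u01.
    have := @jordan_inj gamma' u 0 J' u01; rewrite lexx ler01 => /(_ isT).
    by rewrite -/(X' u) -/(X' 0) Xu X'0 => /(_ erefl) u0'; rewrite u0' ltxx in u0.
  rewrite !lt_neqAle t0 t1 !andbT; apply/andP; split; apply/eqP => h; apply: nz.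
    by rewrite -h.
  by rewrite h.
(* [X] is at the origin at both times 0 and 1; the values at the end points are those that an
   increasing [r] must take. *)
pose r t := if t <= 0 then 0 else if 1 <= t then 1 else rho t.
have r0 : r 0 = 0 by rewrite /r lexx.
have r1 : r 1 = 1 by rewrite /r leNgt ltr01/= lexx.
have rin t : 0 < t < 1 -> 0 < r t < 1 /\ X' t = X (r t).
  by move=> t01; have := Hrho _ t01; case/andP: t01 => t0 t1; rewrite /r !leNgt t0 t1.
have rE t : 0 <= t <= 1 -> 0 <= r t <= 1 /\ X' t = X (r t).
  case/andP; rewrite le_eqVlt => /predU1P[<- _|t0].
    by rewrite r0 lexx ler01 X00 X'0.
  rewrite le_eqVlt => /predU1P[->|t1]; first by rewrite r1 lexx ler01 X1 X'1.
  by have [|/andP[rt0 rt1] ->] := rin t; rewrite ?t0 ?t1// !ltW.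
clearbody r.
have rcont x : 0 < x < 1 -> forall e, 0 < e -> exists2 d, 0 < d &
    forall t, 0 <= t <= 1 -> `|t - x| < d -> `|r t - r x| < e.
  move=> x01 e e0; have [rx01 Xx] := rin x x01; have /andP[rx0 rx1] := rx01.
  (* The points of [X] whose time is at distance at least [e] from [r x]. This closed set misses
     [X' x], so [X' t] avoids it for [t] near [x]. *)
  pose C := X @` `[0, r x - e] `|` X @` `[r x + e, 1].
  have cC : closed C by apply: closedU; apply: closedK; apply: arcX; lra.
  have nC : ~ C (X' x).
    rewrite Xx => -[[tau + Xtau]|[tau + Xtau]]; rewrite /= in_itv /= => /andP[h1 h2].
      have t01 : 0 <= tau <= 1 by apply/andP; split; lra.
      have := jordan_inj J rx01 t01 (esym Xtau); lra.
    have t01 : 0 <= tau <= 1 by apply/andP; split; lra.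
    have := jordan_inj J rx01 t01 (esym Xtau); lra.
  have x01' : 0 <= x <= 1 by case/andP: x01 => ? ?; rewrite !ltW.
  have [d d0 hd] := avoid_closed cg' cC x01' nC.
  exists d => // t t01 tx; have := hd t t01 tx; have [/andP[rt0 rt1] Xt] := rE t t01.
  rewrite -/(X' t) Xt => nCt; rewrite ltr_norml.
  apply/andP; split; rewrite ltNge; apply/negP => h; apply: nCt.
    by left; exists (r t) => //=; rewrite in_itv /=; apply/andP; split; lra.
  by right; exists (r t) => //=; rewrite in_itv /=; apply/andP; split; lra.
have rincr : {in `]0, 1[ &, {homo r : s t / s < t}}.
  have cr : {within `]0, 1[, continuous r}.
    apply/subspace_continuousP => x /=; rewrite in_itv /= => x01.
    apply/cvgrPdist_lt => e e0; have [d d0 hd] := rcont x x01 e e0.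
    rewrite near_withinE; apply/nbhs_ballP; exists d => //= t xt.
    rewrite in_itv /= => /andP[t0 t1]; rewrite distrC; apply: hd; first by rewrite !ltW.
    by rewrite distrC.
  have ir : {in `]0, 1[ &, injective r}.
    move=> u v; rewrite !in_itv /= => u01 v01 ruv.
    have [_ Xu] := rin u u01; have [_ Xv] := rin v v01.
    apply: (jordan_inj J' u01); first by case/andP: v01 => ? ?; rewrite !ltW.
    by rewrite -/(X' u) -/(X' v) Xu Xv ruv.
  (* A continuous injection of an interval with one pair in increasing order is increasing. Without
     such a pair [r] is decreasing, which [no_reversal] excludes. *)
  have [ex|nex] := pselect (exists x y : R,
    [/\ x \in `]0, 1[, y \in `]0, 1[, x < y & r x <= r y]).
    have mono := itv_continuous_inj_le ex cr ir.
    by move=> u v uI vI uv; rewrite (leW_mono_in mono).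
  exfalso; apply: (no_reversal rin) => u v u0 uv v1; rewrite ltNge; apply/negP => ruv.
  by apply: nex; exists u, v; rewrite !in_itv /= u0 v1 (lt_trans u0 uv) (lt_trans uv v1).
have r01 t : 0 < t < 1 -> 0 < r t < 1 by move=> /rin[].
have rhomo : {in `[0, 1] &, {homo r : s t / s < t}}.
  move=> u v; rewrite !in_itv /= => /andP[u0 u1] /andP[v0 v1] uv.
  move: u0; rewrite le_eqVlt => /predU1P[u0|u0].
    rewrite -u0 r0 in uv *; move: v1; rewrite le_eqVlt => /predU1P[->|v1].
      by rewrite r1.
    by have /andP[] : 0 < r v < 1 by apply: r01; rewrite uv.
  move: v1; rewrite le_eqVlt => /predU1P[v1|v1].
    rewrite v1 r1 in uv *.
    by have /andP[] : 0 < r u < 1 by apply: r01; rewrite u0.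
  by apply: rincr => //; rewrite in_itv /= ?u0 ?v1 ?(lt_trans u0 uv) ?(lt_trans uv v1).
have [hf0 hf1] : (0 : R) < 2^-1 /\ (2^-1 : R) < 1 by split; lra.
have half01 : (0 < (2^-1 : R)) && ((2^-1 : R) < 1) by rewrite hf0 hf1.
have /andP[m0 m1] := r01 _ half01.
(* Near an end point [X'] is near the origin, so [r t] is near 0 or near 1; this argument does not
   tell which. *)
have rend x : x = 0 \/ x = 1 -> forall e, 0 < e -> e < r 2^-1 -> e < 1 - r 2^-1 ->
    exists2 d, 0 < d & forall t, 0 < t < 1 -> `|t - x| < d -> r t < e \/ 1 - e < r t.
  move=> x01 e e0 em em1.
  have x01' : 0 <= x <= 1 by case: x01 => ->; rewrite ?lexx ?ler01.
  have cC : closed (X @` `[e, 1 - e]) by apply: closedK; apply: arcX; lra.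
  have nC : ~ (X @` `[e, 1 - e]) (X' x).
    have -> : X' x = X 0 by rewrite X00; case: x01 => ->.
    move=> [tau + Xtau]; rewrite /= in_itv /= => /andP[h1 h2].
    have t01 : 0 < tau < 1 by apply/andP; split; lra.
    have z01 : (0 <= (0 : R)) && ((0 : R) <= 1) by rewrite lexx ler01.
    have := jordan_inj J t01 z01 Xtau; lra.
  have [d d0 hd] := avoid_closed cg' cC x01' nC.
  exists d => // t t01 tx; have [_ Xt] := rin t t01.
  have t01' : 0 <= t <= 1 by case/andP: t01 => ? ?; rewrite !ltW.
  have [h|h] := ltP (r t) e; first by left.
  right; rewrite ltNge; apply/negP => h2; apply: (hd t t01' tx).
  by rewrite -/(X' t) Xt; exists (r t) => //=; rewrite in_itv /= h h2.
have rcontall x : 0 <= x <= 1 -> forall e, 0 < e -> exists2 d, 0 < d &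
    forall t, 0 <= t <= 1 -> `|t - x| < d -> `|r t - r x| < e.
  move=> x01 e e0.
  (* The bounds by [r(1/2)] and [1 - r(1/2)] decide between the two ends: for [t < 1/2] monotonicity
     gives [r t < r(1/2) < 1 - e'], and symmetrically for [t > 1/2]. *)
  have [e' [e'0 e'e e'm e'm1]] : exists e', [/\ 0 < e', e' < e, e' < r 2^-1 & e' < 1 - r 2^-1].
    by apply: below_three; rewrite ?subr_gt0.
  have half t : t = 2^-1 -> t \in `[0, 1].
    by move=> ->; rewrite in_itv /=; case/andP: half01 => ? ?; rewrite !ltW.
  case/andP: (x01); rewrite le_eqVlt => /predU1P[x0 _|x0].
    have [d d0 hd] := rend x (or_introl (esym x0)) e' e'0 e'm e'm1.
    exists (Num.min d 2^-1) => [|t /andP[t0 t1]].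
      by rewrite lt_min d0 invr_gt0 ltr0n.
    rewrite lt_min -x0 subr0 r0 subr0 => /andP[td t2].
    rewrite ger0_norm// in td t2.
    move: t0; rewrite le_eqVlt => /predU1P[<-|t0]; first by rewrite r0 normr0.
    have t01 : 0 < t < 1 by rewrite t0; lra.
    have /andP[rt0 _] := r01 _ t01; rewrite gtr0_norm//.
    have tm : r t < r 2^-1.
      by apply: rhomo => //; [rewrite in_itv /= t1 ltW|exact: half].
    have td' : `|t - x| < d by rewrite -x0 subr0 gtr0_norm.
    have [h|h] := hd t t01 td'; first exact: lt_trans h e'e.
    have := lt_trans h tm; rewrite ltrBlDr -ltrBlDl => h'.
    by have := lt_trans h' e'm1; rewrite ltxx.
  rewrite le_eqVlt => /predU1P[x1|x1]; last by apply: rcont => //; rewrite x0 x1.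
  have [d d0 hd] := rend x (or_intror x1) e' e'0 e'm e'm1.
  exists (Num.min d 2^-1) => [|t /andP[t0 t1]].
    by rewrite lt_min d0 invr_gt0 ltr0n.
  rewrite lt_min => /andP[td t2]; rewrite x1 r1 distrC.
  rewrite x1 distrC ger0_norm ?subr_ge0// in t2.
  move: t1; rewrite le_eqVlt => /predU1P[->|t1]; first by rewrite r1 subrr normr0.
  have t0' : 0 < t by lra.
  have t01 : 0 < t < 1 by rewrite t0'.
  have /andP[_ rt1] := r01 _ t01; rewrite gtr0_norm ?subr_gt0//.
  have tm : r 2^-1 < r t.
    by apply: rhomo; [exact: half|rewrite in_itv /= t0 ltW|lra].
  have [h|h] := hd t t01 td; first by have := lt_trans e'm (lt_trans tm h); rewrite ltxx.
  by apply: lt_trans e'e; rewrite ltrBlDr -ltrBlDl.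
exists r; split => //.
- apply/subspace_continuousP => x /=; rewrite in_itv /= => x01.
  apply/cvgrPdist_lt => e e0; have [d d0 hd] := rcontall x x01 e e0.
  rewrite near_withinE; apply/nbhs_ballP; exists d => //= t xt.
  by rewrite in_itv /= => t01; rewrite distrC; apply: hd => //; rewrite distrC.
- by move=> t; rewrite !in_itv /= => t01; have [] := rE t t01.
- by move=> t; rewrite in_itv /= => t01; have [] := rE t t01.
Qed.

End SameSignature.

(** * Invariance of the signature under translation and reparametrization *)

Lemma dint_comp (W f g Y r : R -> R) : unif_cont01 r ->
  (forall t, 0 <= t <= 1 -> 0 <= r t <= 1) ->
  (forall u v, 0 <= u -> u <= v -> v <= 1 -> r u <= r v) -> dint W f g Y ->
  dint (fun t => W (r t)) (fun t => f (r t)) (fun t => g (r t)) (fun t => Y (r t)).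
Proof.
move=> ucr r01 rnd HY e e0; have [d d0 hd] := HY e e0.
have d2 : 0 < d / 2 by lra.
have [d' d'0 hd'] := ucr _ d2; exists d' => // u v u0 uv v1 uvd.
have /andP[ru0 _] : 0 <= r u <= 1 by apply: r01; rewrite u0 (le_trans uv).
have /andP[_ rv1] : 0 <= r v <= 1 by apply: r01; rewrite v1 (le_trans u0).
have ruv := rnd u v u0 uv v1.
apply: hd => //; have := hd' u v u0 uv v1 uvd.
by rewrite ger0_norm ?subr_ge0//; lra.
Qed.

(** The time change turns the control [W] into its composition with [r] and respects [dint]. By
    induction on the degree, the iterated integral of [gamma'] at [t] is that of [gamma] at [r t],
    as both integrate the same data from 0; the translation [b] drops out of the increments. *)
Lemma signature_reparametrization (d : nat) (W : R -> R) a (gamma gamma' : R -> 'rV[R]_d)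
    (b : 'rV[R]_d) (r : R -> R) :
  control W -> 2^-1 < a -> a <= 1 ->
  {within `[0, 1], continuous gamma'} -> {within `[0, 1], continuous r} ->
  r 0 = 0 -> r 1 = 1 -> (forall u v, 0 <= u -> u <= v -> v <= 1 -> r u <= r v) ->
  (forall t, 0 <= t <= 1 -> gamma' t = b + gamma (r t)) ->
  (forall j, young_path W a (fun t => gamma t 0 j)) ->
  forall k, signature gamma k = signature gamma' k.
Proof.
move=> cW a2 a1 cg' cr r0 r1 rnd E Vg.
have r01 t : 0 <= t <= 1 -> 0 <= r t <= 1.
  move=> /andP[t0 t1]; have := rnd 0 t (lexx 0) t0 t1; have := rnd t 1 t0 t1 (lexx 1).
  by rewrite r0 r1 => -> ->.
have rge0 u v : 0 <= u -> u <= v -> v <= 1 -> 0 <= r u.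
  by move=> u0 uv v1; have /andP[] : 0 <= r u <= 1 by apply: r01; rewrite u0 (le_trans uv).
have rle1 u v : 0 <= u -> u <= v -> v <= 1 -> r v <= 1.
  by move=> u0 uv v1; have /andP[] : 0 <= r v <= 1 by apply: r01; rewrite v1 (le_trans u0).
have cWr : control (fun t => W (r t)).
  split; last by rewrite r0 r1; exact: cW.2.
  by move=> u v u0 uv v1; apply: cW.1 (rge0 u v _ _ _) (rnd u v _ _ _) (rle1 u v _ _ _).
have Eincr u v j : 0 <= u -> u <= v -> v <= 1 ->
    gamma' v 0 j - gamma' u 0 j = gamma (r v) 0 j - gamma (r u) 0 j.
  move=> u0 uv v1; rewrite !E ?u0 ?v1 ?(le_trans uv) ?(le_trans u0)//.
  by rewrite !mxE; ring.
have Vg' j : young_path (fun t => W (r t)) a (fun t => gamma' t 0 j).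
  split; first by apply: continuous_unif_cont01; exact: within_coord.
  have [_ [c c0 hc]] := Vg j; exists c => // u v u0 uv v1.
  by rewrite Eincr//; apply: hc (rge0 u v _ _ _) (rnd u v _ _ _) (rle1 u v _ _ _).
suff H k t : 0 <= t <= 1 -> iterated_integral gamma' k t = iterated_integral gamma k (r t).
  by move=> k; rewrite /signature H ?lexx ?ler01// r1.
elim: k t => [|k IH] t t01.
  by rewrite /= !E ?lexx ?ler01// r0; apply/rowP => j; rewrite !mxE; ring.
apply/rowP; case/mxvec_indexP => c j.
have D := iterated_integral_dint cW a2 a1 Vg c j.
have D' := iterated_integral_dint cWr a2 a1 Vg' c j.
have ucr := continuous_unif_cont01 cr.
have {}D := dint_comp ucr r01 rnd D.
have {}D' : dint (fun t => W (r t)) (fun t => iterated_integral gamma k (r t) 0 c)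
   (fun t => gamma (r t) 0 j)
   (fun t => iterated_integral gamma' k.+1 t 0 (mxvec_index c j)).
  move=> e e0; have [d' d'0 hd'] := D' e e0; exists d' => // u v u0 uv v1 uvd.
  rewrite -Eincr// -IH; first exact: hd'.
  by rewrite u0 (le_trans uv).
have /andP[t0 t1] := t01.
have := dint_sub cWr (lexx 0) t0 t1 D' D.
have z := @iterated_integral0 R d gamma k.+1 (mxvec_index c j).
have z' := @iterated_integral0 R d gamma' k.+1 (mxvec_index c j).
by rewrite r0 z z' !subr0.
Qed.

End JordanCurves.

Unset Implicit Arguments.
Set Strict Implicit.

Theorem theorem3p3 (R : realType) (p : R) (hp1 : 1 <= p) (hp2 : p < 2)
    (gamma gamma' : R -> 'rV[R]_2)
    (hgamma : jordan_curve gamma) (hgamma' : jordan_curve gamma')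
    (hpgamma : finite_pvariation p 0 1 gamma)
    (hpgamma' : finite_pvariation p 0 1 gamma') :
  (forall k : nat, signature gamma k = signature gamma' k) <->
  exists (a : 'rV[R]_2) (r : R -> R),
    [/\ {within `[0, 1], continuous r},
        {in `[0, 1], forall t, r t \in `[0, 1]},
        {in `[0, 1] &, {homo r : s t / s < t}} &
        {in `[0, 1], forall t, gamma' t = a + gamma (r t)}].
Proof.
have p0 : 0 < p by exact: lt_le_trans hp1.
(* [p < 2] becomes the Young condition on the exponent [1 / p]. *)
have p2 : 2^-1 < p^-1 by rewrite ltf_pV2 ?posrE.
have p1 : p^-1 <= 1 by rewrite invf_le1.
have [cg g01 inj] := hgamma; have [cg' g01' _] := hgamma'.
have [W [cW Vg Vg']] := common_control p0 cg cg' hpgamma hpgamma'.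
split=> [S|[b [r [cr rI rhomo E]]]].
  have [r [cr rI rhomo E]] := reparametrization_exists cW p2 p1 hgamma hgamma' Vg Vg' S.
  exists (gamma' 0 - gamma 0), r; split => // t tI.
  have := E t tI; rewrite /centered => /(congr1 (fun z => z + gamma' 0)).
  by rewrite subrK => ->; rewrite addrAC [RHS]addrC addrA.
have I0 : 0 \in `[0 : R, 1] by rewrite in_itv /= lexx ler01.
have I1 : 1 \in `[0 : R, 1] by rewrite in_itv /= lexx ler01.
have r01 : r 0 < r 1 by exact: rhomo.
(* [gamma] takes the same value at [r 0 < r 1], and injectivity on [[0, 1)] leaves only [r 0 = 0]
   and [r 1 = 1]. *)
have gr : gamma (r 0) = gamma (r 1).
  by apply: (@addrI _ b); rewrite -E// -E.
have := rI _ I0; have := rI _ I1; rewrite !in_itv /= => /andP[r10 r11] /andP[r00 _].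
have r0in : r 0 \in `[0, 1[ by rewrite in_itv /= r00 (lt_le_trans r01).
have r1 : r 1 = 1.
  apply/eqP; rewrite eq_le r11 leNgt; apply/negP => r1lt.
  have := inj _ (r 1) r0in; rewrite in_itv /= r10 r1lt => /(_ isT gr) h.
  by rewrite h ltxx in r01.
have r0 : r 0 = 0.
  by apply: inj => //; rewrite ?in_itv /= ?lexx ?ltr01// gr r1 g01.
apply: (signature_reparametrization cW p2 p1 cg' cr r0 r1 _ _ Vg) => [u v u0 uv v1|t t01].
  have := uv; rewrite le_eqVlt => /predU1P[->//|uv']; apply/ltW/rhomo => //.
    by rewrite in_itv /= u0 (le_trans uv).
  by rewrite in_itv /= v1 (le_trans u0).
by apply: E; rewrite in_itv.
Qed.
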